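(* Let $K$ be a field, let $G$ be a Cohen--Macaulay bipartite graph without isolated vertices, with vertex set $V(G)=\{t_1,\ldots,t_s\}$ and at least one edge, let $S=K[t_1,\ldots,t_s]$ with the standard grading, and let $I=I(G)\subset S$ be the edge ideal of $G$. Then $\delta_I(d)=1$ for all integers $d\geq{\rm reg}(S/I)$ with $d\ge 1$.
   Context: Graphs are finite and simple. The edge ideal $I(G)$ is the ideal of $S$ generated by all monomials $\prod_{t_i\in e}t_i$ with $e\in E(G)$. $G$ is Cohen--Macaulay if $S/I(G)$ is Cohen--Macaulay. ${\rm reg}(S/I)$ is the Castelnuovo--Mumford regularity: if $0\to\bigoplus_jS(-j)^{b_{gj}}\to\cdots\to\bigoplus_jS(-j)^{b_{1j}}\to S\to S/I\to 0$ is the minimal graded free resolution of $S/I$, then ${\rm reg}(S/I)=\max\{j-i: b_{ij}\neq 0\}$. $S=\bigoplus_{d\ge 0}S_d$ is the standard graded polynomial ring and $\mathbb{N}_+$ is the set of positive integers. For a proper graded ideal $J$ of $S$ with $k=\dim(S/J)$ (Krull dimension) and Hilbert function $H_J(d)=\dim_K(S_d/J_d)$, the degree (multiplicity) is $\deg(S/J)=(k-1)!\lim_{d\to\infty}H_J(d)/d^{k-1}$ if $k\geq 1$ and $\deg(S/J)=\dim_K(S/J)$ if $k=0$. $(J\colon f)=\{h\in S: hf\in J\}$. For $d\geq 1$, let $\mathcal{F}_d=\{f\in S_d: f\notin I,\ (I\colon f)\neq I\}$. The minimum distance function $\delta_I\colon\mathbb{N}_+\to\mathbb{Z}$ of $I$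 is $\delta_I(d)=\deg(S/I)-\max\{\deg(S/(I,f)): f\in\mathcal{F}_d\}$ if $\mathcal{F}_d\neq\emptyset$, and $\delta_I(d)=\deg(S/I)$ if $\mathcal{F}_d=\emptyset$. *)

(* Defs.v *)
From HB Require Import structures.
From mathcomp Require Import all_boot all_order all_algebra ring_quotient.
From mathcomp Require Import boolp.
From mathcomp.multinomials Require Import mpoly.

Set Implicit Arguments.
Unset Strict Implicit.
Unset Printing Implicit Defensive.

Import Order.TTheory GRing.Theory Num.Theory.
Local Open Scope ring_scope.

(* Conventions.  S is {mpoly K[s]}, the variable t_i being 'X_i with i : 'I_s.
   An ideal of S is a collective predicate on S; J : {pred S} stands for the
   ideal throughout.  Numerical invariants (Krull dimension, depth, degree,
   regularity, minimum distance) are stated as functional relations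
   "has_xxx J n", so that no value is assigned when the invariant is not
   defined. *)

Definition ideal_gen (R : comNzRingType) (A : {pred R}) : {pred R} :=
  fun f => `[< exists2 cs : seq (R * R),
                 all (fun c => c.2 \in A) cs & f = \sum_(c <- cs) c.1 * c.2 >].

Definition colon (R : comNzRingType) (J : {pred R}) (f : R) : {pred R} :=
  [pred h | h * f \in J].

Definition bipartite (s : nat) (G : rel 'I_s) : Prop :=
  exists A : {set 'I_s}, forall i j, G i j -> (i \in A) != (j \in A).

Definition edge_ideal (K : fieldType) (s : nat) (G : rel 'I_s) :
    {pred {mpoly K[s]}} :=
  ideal_gen [pred f | [exists i, exists j, G i j && (f == 'X_i * 'X_j)]].
Arguments edge_ideal K [s] G _.

(* Primes of R / J are identified with the primes of R containing J;
   idealr_closed includes properness. *)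
Definition prime_chain (R : comNzRingType) (J : {pred R}) (k : nat) : Prop :=
  exists P : nat -> {pred R},
    (forall i, (i <= k)%N ->
       [/\ idealr_closed (P i), prime_idealr_closed (P i)
         & {subset J <= P i}]) /\
    (forall i, (i < k)%N ->
       {subset P i <= P i.+1} /\ ~ {subset P i.+1 <= P i}).

Definition has_krull_dim (R : comNzRingType) (J : {pred R}) (k : nat) : Prop :=
  prime_chain J k /\ forall l, prime_chain J l -> (l <= k)%N.

(* fs is a regular sequence on R / J. *)
Definition regular_seq (R : comNzRingType) (J : {pred R}) (fs : seq R) : Prop :=
  let Jmod gs := ideal_gen [predU J & mem gs] in
  (forall i, (i < size fs)%N ->
     forall h, h * fs`_i \in Jmod (take i fs) -> h \in Jmod (take i fs)) /\
  1 \notin Jmod fs.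

(* dim_K (V / W), for subspaces W of V: the size of a basis of V modulo W. *)
Definition has_quot_dim (K : fieldType) (E : lmodType K) (V W : {pred E})
    (n : nat) : Prop :=
  exists b : 'I_n -> E,
    [/\ forall i, b i \in V,
        forall c : 'I_n -> K, \sum_i c i *: b i \in W -> forall i, c i = 0
      & forall v, v \in V -> exists c : 'I_n -> K, v - \sum_i c i *: b i \in W].

Definition rat_cvg (u : nat -> rat) (l : rat) : Prop :=
  forall eps : rat, 0 < eps ->
    exists N, forall n, (N <= n)%N -> `|u n - l| < eps.

Section GradedIdeals.
Variables (K : fieldType) (s : nat).
Local Notation S := {mpoly K[s]}.
Implicit Types (J : {pred S}) (d k n r : nat).

Definition irrelevant : {pred S} := [pred f | f@_0%MM == 0].

Definition has_depth J r : Prop :=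
  (exists fs : seq S,
     [/\ size fs = r, {subset fs <= irrelevant} & regular_seq J fs]) /\
  (forall fs : seq S,
     {subset fs <= irrelevant} -> regular_seq J fs -> (size fs <= r)%N).

Definition cohen_macaulay J : Prop :=
  exists k, has_krull_dim J k /\ has_depth J k.

Definition graded_part d : {pred S} := [pred f | f \is d.-homog].

Definition has_hilbert_function J (H : nat -> nat) : Prop :=
  forall d, has_quot_dim (graded_part d) [predI graded_part d & J] (H d).

(* The degree is an integer, so the limit may be taken in the rationals. *)
Definition has_degree J (e : nat) : Prop :=
  exists2 k, has_krull_dim J k &
    if k == 0%N then has_quot_dim predT J e
    else exists2 H, has_hilbert_function J H &
      rat_cvg (fun d => (k.-1)`!%:R * ((H d)%:R / d%:R ^+ k.-1)) e%:R.

(* Minimal graded free resolution of S / J.  The i-th module is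
   F_i = \bigoplus_(a <- shifts i) S(-a); elements of F_i are row vectors and
   the map F_(i+1) -> F_i is right multiplication by diff i.  Shifts can be
   taken in nat: F_0 = S, and in a minimal resolution the generators of
   F_(i+1) have degree larger than the least shift of F_i. *)
Record min_free_resolution J := MinFreeResolution {
  shifts : nat -> seq nat;
  diff : forall i, 'M[S]_(size (shifts i.+1), size (shifts i));
  shifts0 : shifts 0 = [:: 0%N];
  shifts_finite : exists g, forall i, (g < i)%N -> shifts i = [::];
  diff_graded : forall i p q, diff i p q != 0 ->
    exists2 k, nth 0%N (shifts i.+1) p = (nth 0%N (shifts i) q + k)%N
             & diff i p q \is k.-homog;
  diff_minimal : forall i p q, diff i p q \in irrelevant;
  diff_exact0 : forall w : 'rV[S]_(size (shifts 0)),
    (forall q, w 0 q \in J) <-> (exists v, w = v *m diff 0);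
  diff_exact : forall i (w : 'rV[S]_(size (shifts i.+1))),
    (w *m diff i = 0) <-> (exists v, w = v *m diff i.+1)
}.

Definition betti J (F : min_free_resolution J) (i j : nat) : nat :=
  count_mem j (shifts F i).

Definition has_regularity J (r : int) : Prop :=
  exists F : min_free_resolution J,
    (exists i j, betti F i j != 0%N /\ r = j%:Z - i%:Z) /\
    (forall i j, betti F i j != 0%N -> j%:Z - i%:Z <= r).

Definition zero_divisor_forms J d (f : S) : Prop :=
  [/\ f \in graded_part d, f \notin J & ~ (colon J f =i J)].

Definition is_max_degree J d (m : nat) : Prop :=
  (exists2 f, zero_divisor_forms J d f
            & has_degree (ideal_gen [predU1 f & J]) m) /\
  (forall f m', zero_divisor_forms J d f ->
     has_degree (ideal_gen [predU1 f & J]) m' -> (m' <= m)%N).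

Definition has_min_distance J d (v : int) : Prop :=
  exists2 e, has_degree J e &
    ((exists f, zero_divisor_forms J d f) /\
       exists2 m, is_max_degree J d m & v = e%:Z - m%:Z) \/
    ((forall f, ~ zero_divisor_forms J d f) /\ v = e%:Z).

End GradedIdeals.

(* Main.v *)
Require Import Defs.
From mathcomp Require Import all_boot all_order all_algebra ring_quotient.
From mathcomp Require Import boolp.
From mathcomp.multinomials Require Import mpoly.
From mathcomp Require Import zify ring lra.
Import Order.TTheory GRing.Theory Num.Theory.
Local Open Scope ring_scope.
Set Implicit Arguments.
Unset Strict Implicit.
Unset Printing Implicit Defensive.

(** Write [I] for the edge ideal.  Its minimal primes are the ideals generated by
    the minimal vertex covers, that is, the linear primes on the complements of
    the maximal independent sets, and [I] is their intersection.

    Unmixedness.  Since S/I is Cohen-Macaulay, all maximal independent sets have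
    the size of the Krull dimension k ([cohen_macaulay_maxindep]).  A chain of
    linear primes bounds the dimension from below, and the depth is at most the
    dimension of S/p for each associated prime p ([depth_le_annihilator]).  The latter is
    proved by a dimension count: powers of a regular sequence are again regular
    ([regular_expr]), and a regular sequence is algebraically independent, even
    on the submodule generated by a monomial that it does not reach
    ([power_prod_free]).

    Degrees.  The Hilbert function of S/I counts the monomials with independent
    support; as all facets have size k, its leading coefficient gives the number
    e of facets as degree.  A form f outside [I] misses a minimal prime p, so
    multiplication by f embeds a shift of S/p in S/I
    ([hilbert_zero_divisor]); hence the degree of S/(I, f) is at most e - 1.
    A zero divisor lies in a minimal prime, so the dimension is still k.
    Equality holds when the colon ideal of [I] by f is a minimal prime
    ([degree_monomial]).

    Regularity.  Let B be one side of the bipartition.  In a minimal set A of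
    vertices on the other side whose neighbourhood is B, every vertex has a
    private neighbour, so the edges to these neighbours form an induced matching
    ([minimal_dominating_matching]).  An induced matching with a edges yields a
    nonzero Koszul homology class of degree 2a in homological degree a.  Lifting
    this class along the minimal free resolution, as in the proof that Tor is
    balanced ([zigzag]), produces a generator of degree 2a in step a, so that
    a = #|A| is at most the regularity ([dominating_le_regularity]).

    For d at least the regularity the product of the vertices in A can therefore
    be padded to a monomial of degree d with support A.  The colon ideal of [I]
    by this monomial is the minimal prime generated by B, because A is
    independent and dominates B.  So e - 1 is the maximal degree, and the minimum
    distance is 1. *)

(** * Linear primes and monomial ideals *)

Section MonomialIdeals.
Variables (K : fieldType) (s : nat).
Local Notation S := {mpoly K[s]}.
Implicit Types (f g : S) (m : 'X_{1..s}) (C : {set 'I_s}).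

Definition mvars m : {set 'I_s} := [set i | m i != 0%N].

Definition avoids C m := [disjoint mvars m & C].

(** The prime ideal generated by the variables in [C]. *)
Definition linprime C : {pred S} :=
  [pred f | all (fun m => ~~ avoids C m) (msupp f)].

Lemma linprimeP C f :
  reflect (forall m, f@_m != 0 -> ~~ avoids C m) (f \in linprime C).
Proof.
apply: (iffP allP) => H m; first by rewrite -mcoeff_msupp; exact: H.
by rewrite mcoeff_msupp; exact: H.
Qed.

Lemma avoidsP C m : reflect (forall i, i \in C -> m i = 0%N) (avoids C m).
Proof.
apply: (iffP idP) => [H i iC | H].
  apply/eqP; apply: contraTT iC => mi.
  by have := disjointFr H; move=> /(_ i) ->; rewrite ?inE.
rewrite /avoids disjoint_subset; apply/subsetP => i; rewrite !inE.
by apply: contra => /H ->.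
Qed.

(** Setting the variables in [C] to zero is a ring endomorphism of a domain; its
    kernel is [linprime C], which is therefore prime. *)
Definition killvars C f : S :=
  f \mPo [tuple (if i \in C then 0 else 'X_i) | i < s].

Lemma killvarsX C m : killvars C 'X_[m] = (avoids C m)%:R *: 'X_[m].
Proof.
rewrite /killvars comp_mpolyX.
case: avoidsP => [H|H].
  rewrite scale1r [RHS]mpolyXE_id; apply: eq_bigr => i _.
  by rewrite tnth_mktuple; case: ifP => // /H ->.
have /existsP[i /andP[iC mi]] : [exists i, (i \in C) && (m i != 0%N)].
  apply/existsP; apply/not_existsP => H'; apply: H => i iC.
  apply/eqP/negPn/negP => mi; apply: (H' i); by rewrite iC.
by rewrite (bigD1 i) //= tnth_mktuple iC expr0n (negbTE mi) mul0r scale0r.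
Qed.

Lemma mcoeff_killvars C f m : (killvars C f)@_m = (avoids C m)%:R * f@_m.
Proof.
rewrite /killvars comp_mpolyEX [in RHS](mpolyE f) !(raddf_sum (mcoeff m)).
rewrite mulr_sumr; apply: eq_bigr => m' _.
rewrite /= !mcoeffZ -/(killvars C _) killvarsX mcoeffZ mcoeffX.
by case: eqVneq => [->|_]; rewrite ?mulr0 // !mulr1 mulrC.
Qed.

Lemma killvars_eq0 C f : (f \in linprime C) = (killvars C f == 0).
Proof.
apply/linprimeP/eqP => [H|H m fm].
  apply/mpolyP => m; rewrite mcoeff_killvars mcoeff0.
  have [->|/H/negbTE->] := eqVneq (f@_m) 0; first by rewrite mulr0.
  by rewrite mul0r.
have := mcoeff_killvars C f m; rewrite H mcoeff0; case: avoids => //.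
by rewrite mul1r => /eqP; rewrite eq_sym (negbTE fm).
Qed.

Lemma linprime0 C : 0 \in linprime C.
Proof. by rewrite killvars_eq0 /killvars raddf0. Qed.

Lemma linprimeD C : {in linprime C &, forall f g, f + g \in linprime C}.
Proof.
move=> f g; rewrite !killvars_eq0 /killvars comp_mpolyD => /eqP-> /eqP->.
by rewrite addr0.
Qed.

Lemma linprimeM C f g :
  (f * g \in linprime C) = (f \in linprime C) || (g \in linprime C).
Proof. by rewrite !killvars_eq0 /killvars rmorphM mulf_eq0. Qed.

Lemma linprimeX C m : ('X_[m] \in linprime C) = ~~ avoids C m.
Proof.
rewrite killvars_eq0 killvarsX; case: avoids; rewrite ?scale0r ?eqxx //.
by rewrite scale1r; apply/negbTE/eqP => /(congr1 (mcoeff m))/eqP;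
  rewrite mcoeffX eqxx mcoeff0 oner_eq0.
Qed.

Lemma linprime_closed C : idealr_closed (linprime C).
Proof.
split; first exact: linprime0.
  rewrite -mpolyX0 linprimeX negbK; apply/avoidsP => i _; exact: mnm0E.
by move=> a u v uC vC; rewrite linprimeD ?linprimeM ?uC ?orbT.
Qed.

Lemma linprime_prime C : prime_idealr_closed (linprime C).
Proof. by move=> u v; rewrite linprimeM. Qed.

Lemma linprimeS C C' : C \subset C' -> {subset linprime C <= linprime C'}.
Proof.
move=> CC' f /linprimeP H; apply/linprimeP => m /H.
by apply: contra => /avoidsP H'; apply/avoidsP => i /(subsetP CC')/H'.
Qed.

End MonomialIdeals.

Arguments linprime K [s] C _.

Section IdealGen.
Variable R : comNzRingType.
Implicit Types (A J : {pred R}).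

Lemma ideal_genP A (x : R) :
  x \in ideal_gen A <-> exists2 cs : seq (R * R),
    all (fun c => c.2 \in A) cs & x = \sum_(c <- cs) c.1 * c.2.
Proof. by rewrite /ideal_gen unfold_in asboolE. Qed.

Lemma mem_ideal_gen A x : x \in A -> x \in ideal_gen A.
Proof.
move=> xA; apply/ideal_genP; exists [:: (1, x)]; first by rewrite /= xA.
by rewrite big_seq1 mul1r.
Qed.

Lemma ideal_gen0 A : 0 \in ideal_gen A.
Proof. by apply/ideal_genP; exists [::] => //; rewrite big_nil. Qed.

Lemma ideal_genD A : {in ideal_gen A &, forall x y, x + y \in ideal_gen A}.
Proof.
move=> x y /ideal_genP[cs csA ->] /ideal_genP[ds dsA ->]; apply/ideal_genP.
by exists (cs ++ ds); rewrite ?all_cat ?csA // big_cat.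
Qed.

Lemma ideal_genM A a x : x \in ideal_gen A -> a * x \in ideal_gen A.
Proof.
move=> /ideal_genP[cs csA ->]; apply/ideal_genP.
exists [seq (a * c.1, c.2) | c <- cs]; first by rewrite all_map.
by rewrite big_map mulr_sumr; apply: eq_bigr => c _; rewrite mulrA.
Qed.

Lemma ideal_genB A : {in ideal_gen A &, forall x y, x - y \in ideal_gen A}.
Proof. by move=> x y xA yA; rewrite ideal_genD // -mulN1r ideal_genM. Qed.

Lemma ideal_gen_sum A (I : Type) (r : seq I) (P : pred I) (F : I -> R) :
  (forall i, P i -> F i \in ideal_gen A) ->
  \sum_(i <- r | P i) F i \in ideal_gen A.
Proof.
move=> H; elim/big_rec: _ => [|i f Pi fC]; first exact: ideal_gen0.
exact: ideal_genD (H _ Pi) fC.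
Qed.

Lemma ideal_gen_min A (J : R -> Prop) :
  J 0 -> (forall a x y, J x -> J y -> J (a * x + y)) ->
  (forall x, x \in A -> J x) -> forall x, x \in ideal_gen A -> J x.
Proof.
move=> J0 JMD AJ x /ideal_genP[cs]; elim: cs x => [|c cs IH] x /=.
  by move=> _ ->; rewrite big_nil.
case/andP=> cA csA ->; rewrite big_cons; apply: JMD; first exact: AJ.
exact: IH.
Qed.

End IdealGen.

Section GenMonomial.
Variables (K : fieldType) (s : nat).
Local Notation S := {mpoly K[s]}.

Lemma upward_closed_ideal (D : 'X_{1..s} -> Prop) (a x y : S) :
  (forall m m', D m -> D (m' + m)%MM) ->
  (forall m, x@_m != 0 -> D m) -> (forall m, y@_m != 0 -> D m) ->
  forall m, (a * x + y)@_m != 0 -> D m.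
Proof.
move=> up Hx Hy m; rewrite mcoeffD => Hm.
have [xm|ym] : (a * x)@_m != 0 \/ y@_m != 0.
- have [E|] := eqVneq ((a * x)@_m) 0; last by left.
  by right; move: Hm; rewrite E add0r.
- move: xm; rewrite -mcoeff_msupp => /msuppM_le /allpairsP[[m1 m2] /= [_]].
  by rewrite mcoeff_msupp => /Hx Dm ->; apply: up.
- exact: Hy.
Qed.

(** The polynomials all of whose monomials are divisible by one of the
    generators form an ideal, and each of them is a combination of such
    monomials. *)
Lemma monomial_idealP (A : {pred S}) (D : 'X_{1..s} -> Prop) :
  (forall f, f \in A -> exists2 a, f = 'X_[a] & D a) ->
  (forall a, D a -> 'X_[a] \in A) ->
  forall f, f \in ideal_gen A <->
    forall m, f@_m != 0 -> exists2 a, D a & (a <= m)%MM.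
Proof.
move=> AD DA f; split.
  move: f; apply: ideal_gen_min.
  - by move=> m; rewrite mcoeff0 eqxx.
  - move=> a x y; apply: upward_closed_ideal => m m' [b Db bm]; exists b => //.
    exact: lepm_trans bm (lem_addl _ _).
  - move=> x /AD[a -> Da] m; rewrite mcoeffX; case: (eqVneq a m) => [<- _|_].
      by exists a => //; exact: lepm_refl.
    by rewrite eqxx.
move=> H; rewrite (mpolyE f) big_seq; apply: ideal_gen_sum => m.
rewrite mcoeff_msupp => /H[a Da am].
rewrite -(submK am) -mul_mpolyC mpolyXD mulrA; apply: ideal_genM.
exact/mem_ideal_gen/DA.
Qed.

End GenMonomial.

(** * Regular sequences *)

Section RegularSequences.
Variable R : comNzRingType.
Implicit Types (J : R -> Prop) (x y : R) (xs : seq R).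

(** Ideals as propositional sets, since membership in J + (x) below is an
    existential statement. *)
Record isideal J : Prop := IsIdeal {
  isideal0 : J 0;
  isidealMD : forall a x y, J x -> J y -> J (a * x + y) }.

Lemma isidealD J x y : isideal J -> J x -> J y -> J (x + y).
Proof. by move=> HJ Jx Jy; rewrite -[x]mul1r; apply: isidealMD. Qed.

Lemma isidealM J a x : isideal J -> J x -> J (a * x).
Proof.
by move=> HJ Jx; rewrite -[_ * _]addr0; apply: isidealMD => //; apply: isideal0.
Qed.

Lemma isidealB J x y : isideal J -> J x -> J y -> J (x - y).
Proof. by move=> HJ Jx Jy; rewrite -mulN1r addrC; apply: isidealMD. Qed.

(** The ideal J + (x). *)
Definition adj J x : R -> Prop := fun f => exists c, J (f - c * x).

Definition adjs J xs : R -> Prop := foldl adj J xs.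

Lemma adj_ideal J x : isideal J -> isideal (adj J x).
Proof.
move=> HJ; split; first by exists 0; rewrite mul0r subr0; apply: isideal0.
move=> a f g [c Jf] [e Jg]; exists (a * c + e).
have -> : a * f + g - (a * c + e) * x = a * (f - c * x) + (g - e * x) by ring.
exact: isidealMD.
Qed.

Lemma adjs_ideal J xs : isideal J -> isideal (adjs J xs).
Proof. by elim: xs J => //= x xs IH J HJ; apply/IH/adj_ideal. Qed.

Lemma sub_adj J x f : J f -> adj J x f.
Proof. by move=> Jf; exists 0; rewrite mul0r subr0. Qed.

Lemma adjs_min J J' xs f : isideal J' -> (forall g, J g -> J' g) ->
  (forall x, x \in xs -> J' x) -> adjs J xs f -> J' f.
Proof.
move=> HJ'; elim: xs J => [|x xs IH] J JJ' /= xsJ'; first exact: JJ'.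
apply: IH => [g [c Jg]|y yxs]; last by apply: xsJ'; rewrite inE yxs orbT.
rewrite -(subrK (c * x) g); apply: isidealD => //; first exact: JJ'.
by apply: isidealM => //; apply: xsJ'; rewrite mem_head.
Qed.

Lemma sub_adjs J xs f : J f -> adjs J xs f.
Proof. by elim: xs J => //= x xs IH J Jf; apply/IH/sub_adj. Qed.

Lemma mem_adjs J xs x : isideal J -> x \in xs -> adjs J xs x.
Proof.
elim: xs J => //= y xs IH J HJ; rewrite inE => /predU1P[->|xxs].
  by apply: sub_adjs; exists 1; rewrite mul1r subrr; apply: isideal0.
by apply: IH => //; apply: adj_ideal.
Qed.

(** Recursion on the sequence, with [J] varying: this is the form in which an
    exact sequence of quotients can be carried through an induction. *)
Fixpoint regular J xs : Prop :=
  if xs is x :: xs' then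
    (forall h, J (h * x) -> J h) /\ regular (adj J x) xs'
  else True.

(** The relation between [J1], [J2] and [J3] is exactness of
    0 -> R/J1 -> R/J3 -> R/J2 -> 0, the first map being multiplication by [t];
    tensoring with R/y keeps it exact because [y] is regular on R/J2, and then
    [y] is regular on the middle term because it is on the outer ones. *)
Lemma regular_extension J1 J2 J3 t xs :
  isideal J1 -> isideal J2 -> isideal J3 ->
  (forall h, J2 h <-> adj J3 t h) -> (forall h, J3 (h * t) <-> J1 h) ->
  regular J1 xs -> regular J2 xs -> regular J3 xs.
Proof.
elim: xs J1 J2 J3 => //= y xs IH J1 J2 J3 H1 H2 H3 E2 E1 [y1 R1] [y2 R2].
have tJ2 a : J2 (a * t) by apply/E2; exists a; rewrite subrr; apply: isideal0.
have J32 h : J3 h -> J2 h by move=> /(sub_adj t)/E2.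
split.
  move=> h J3hy; have /y2/E2[a Ja] := J32 _ J3hy.
  rewrite -(subrK (a * t) h); apply: isidealD => //; apply/E1/y1/E1.
  have -> : a * y * t = h * y - y * (h - a * t) by ring.
  by apply: isidealB => //; apply: isidealM.
apply: IH R1 R2; try exact: adj_ideal.
- move=> h; split=> [[c /E2[a Ja]]|[a [c Jc]]].
    by exists a, c; rewrite addrAC.
  by exists c; apply/E2; exists a; rewrite addrAC.
- move=> h; split=> [[e Je]|[c /E1 Jc]].
    have /y2/E2[a Ja] : J2 (e * y).
      rewrite -[e * y](subKr (h * t)); apply: isidealB => //; exact: J32.
    exists a; apply/E1.
    have -> : (h - a * y) * t = (h * t - e * y) + y * (e - a * t) by ring.
    by apply: isidealD => //; apply: isidealM.
  by exists (c * t); rewrite -mulrA [t * y]mulrC mulrA -mulrBl.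
Qed.

(** Induction on the exponent along the extension of R/(J, x ^ a.+1) by
    R/(J, x) that R/(J, x ^ a.+2) is. *)
Lemma regular_expr_hd J x xs a :
  isideal J -> regular J (x :: xs) -> regular (adj J (x ^+ a.+1)) xs.
Proof.
move=> HJ [Jx Jxs]; elim: a => [|a IH]; first by rewrite expr1.
apply: (@regular_extension (adj J x) (adj J (x ^+ a.+1)) _ (x ^+ a.+1)) => //;
  try exact: adj_ideal.
- move=> h; split=> [[c Jc]|[c [e Je]]].
    by exists c; apply: sub_adj.
  exists (c + e * x); have -> : h - (c + e * x) * x ^+ a.+1
    = h - c * x ^+ a.+1 - e * x ^+ a.+2 by rewrite [x ^+ a.+2]exprS; ring.
  exact: Je.
- move=> h; split=> [[c Jc]|[c Jc]]; exists c.
    have : J ((h - c * x) * x ^+ a.+1).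
      by rewrite mulrBl -mulrA -exprS.
    elim: a.+1 (h - c * x) => [|b IHb] g; first by rewrite expr0 mulr1.
    by rewrite exprS mulrA => /IHb/Jx.
  rewrite [x ^+ a.+2]exprS mulrA -mulrBl mulrC; exact: isidealM.
Qed.

(** High powers of a regular sequence in the irrelevant ideal lie in a high
    power of that ideal, hence do not generate a given monomial. *)
Lemma regular_expr J xs a :
  isideal J -> regular J xs -> regular J [seq x ^+ a.+1 | x <- xs].
Proof.
elim: xs J => //= x xs IH J HJ Jxxs; split; last first.
  by apply: IH; [exact: adj_ideal | exact: regular_expr_hd].
case: Jxxs => Jx _ h.
elim: a.+1 => [|b IHb]; first by rewrite expr0 mulr1.
by rewrite exprSr mulrA => /Jx/IHb.
Qed.

Lemma regular_prefixes J xs :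
  (forall i, (i < size xs)%N -> forall h,
     adjs J (take i xs) (h * xs`_i) -> adjs J (take i xs) h) ->
  regular J xs.
Proof.
elim: xs J => //= x xs IH J H; split; first by move=> h; apply: (H 0%N).
by apply: IH => i ixs h; apply: (H i.+1).
Qed.

End RegularSequences.

Section GenAdjoin.
Variables (R : comNzRingType) (A : {pred R}).
Let J := ideal_gen A.
Let inJ : R -> Prop := fun f => f \in J.

Lemma ideal_gen_isideal : isideal inJ.
Proof.
split; first exact: ideal_gen0.
by move=> a x y xJ yJ; apply: ideal_genD => //; apply: ideal_genM.
Qed.

Lemma ideal_gen_adjs xs f :
  f \in ideal_gen [predU J & mem xs] <-> adjs inJ xs f.
Proof.
have HJ := ideal_gen_isideal; split.
  have Hxs := adjs_ideal xs HJ.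
  move: f; apply: ideal_gen_min; first exact: isideal0.
    by move=> a x y; apply: isidealMD.
  move=> x; rewrite !inE => /orP[xJ|xxs]; first exact: sub_adjs.
  exact: mem_adjs.
apply: (@adjs_min _ inJ (fun g => g \in ideal_gen [predU J & mem xs])).
- split; first exact: ideal_gen0.
  by move=> a x y Hx Hy; apply: ideal_genD => //; apply: ideal_genM.
- by move=> g gJ; apply: mem_ideal_gen; rewrite !inE gJ.
- by move=> x xxs; apply: mem_ideal_gen; rewrite !inE xxs orbT.
Qed.

Lemma regular_seq_regular xs : regular_seq J xs -> regular inJ xs.
Proof.
case=> H _; apply: regular_prefixes => i ixs h.
by move/ideal_gen_adjs => Hh; apply/ideal_gen_adjs/H.
Qed.

End GenAdjoin.

Section Independence.
Variables (K : fieldType) (S : comAlgType K).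
Variable D : nat.

(** Exponent vectors are nested pairs, so that the exponent of the first member
    of a sequence splits off by computation. *)
Fixpoint expvec k : finType := if k is k'.+1 then ('I_D * expvec k')%type else unit.

Lemma card_expvec k : #|{: expvec k}| = (D ^ k)%N.
Proof.
by elim: k => [|k IH]; rewrite ?card_unit //= card_prod card_ord IH expnS.
Qed.

Fixpoint power_prod (xs : seq S) : expvec (size xs) -> S :=
  if xs is x :: xs' then fun b => x ^+ b.1 * power_prod b.2 else fun=> 1.

(** A regular sequence is algebraically independent over [K], even after
    multiplication by [u]: the lowest power of the first member can be cancelled
    from a relation modulo [J], and what remains is a relation among the other
    members modulo [J] and the first one. *)
Lemma power_prod_free (J : S -> Prop) xs u (c : expvec (size xs) -> K) :
  isideal J -> regular J xs -> ~ adjs J xs u ->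
  J ((\sum_b c b *: power_prod b) * u) -> forall b, c b = 0.
Proof.
have JZ J' (a : K) x : isideal J' -> J' x -> J' (a *: x).
  by move=> HJ Jx; rewrite -[x]mul1r scalerAl; apply: isidealM.
elim: xs J c => [|x xs IH] J c HJ /=.
  move=> _ Ju; rewrite (big_pred1 tt) => [|[]//] Jc [].
  have [//|c0] := eqVneq (c tt) 0; case: Ju.
  rewrite -[u]scale1r -(mulVf c0) -scalerA; apply: JZ => //.
  by rewrite -[u]mul1r scalerAl.
move=> [Jx Jxs] Ju Jc.
suff H n (b : 'I_D) : b = n :> nat -> forall b', c (b, b') = 0.
  by case=> b b'; exact: H.
elim/ltn_ind: n b => n IHn b bn.
(* the part of the relation with exponent n, seen modulo x *)
apply: IH Ju _ => //; first exact: adj_ideal.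
have : J ((\sum_(a : 'I_D | (n <= a)%N) \sum_b'
             c (a, b') *: (x ^+ (a - n) * power_prod b')) * u * x ^+ n).
  suff -> : (\sum_(a : 'I_D | (n <= a)%N) \sum_b'
             c (a, b') *: (x ^+ (a - n) * power_prod b')) * u * x ^+ n =
     (\sum_b0 c b0 *: (x ^+ b0.1 * power_prod b0.2)) * u by [].
  rewrite mulrAC; congr (_ * u).
  transitivity (\sum_(a : 'I_D) \sum_b' c (a, b') *: (x ^+ a * power_prod b'));
    last by rewrite pair_bigA; apply: eq_bigr => [[a b']].
  rewrite [RHS](bigID (fun a : 'I_D => (n <= a)%N)) /= [X in _ = _ + X]big1 ?addr0; last first.
    move=> a; rewrite -ltnNge => an; apply: big1 => b' _.
    by rewrite (IHn a an a erefl) scale0r.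
  rewrite mulr_suml; apply: eq_bigr => a na; rewrite mulr_suml.
  apply: eq_bigr => b' _; rewrite -scalerAl mulrAC -exprD subnK //.
have Jxn g : J (g * x ^+ n) -> J g.
  elim: (n) => [|n' IH'] ; first by rewrite expr0 mulr1.
  by rewrite exprSr mulrA => /Jx/IH'.
move/Jxn; rewrite (bigD1 b) /=; last by rewrite bn.
move=> Jn.
exists (- (\sum_(a : 'I_D | (n <= a)%N && (a != b)) \sum_b'
             c (a, b') *: (x ^+ (a - n).-1 * power_prod b')) * u).
move: Jn; congr (J _); rewrite mulrDl; congr (_ * u + _).
  by apply: eq_bigr => b' _; rewrite bn subnn expr0 mul1r.
rewrite !mulNr opprK mulrAC; congr (_ * u).
rewrite mulr_suml; apply: eq_bigr => a /andP[na ab].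
rewrite mulr_suml; apply: eq_bigr => b' _.
rewrite -scalerAl mulrAC -exprSr prednK //.
by rewrite subn_gt0 ltn_neqAle na andbT -bn eq_sym.
Qed.

End Independence.

(** * Depth and dimension *)

Lemma exists_left_kernel (K : fieldType) (m n : nat) (M : 'M[K]_(m, n)) :
  (n < m)%N -> exists2 v : 'rV_m, v != 0 & v *m M = 0.
Proof.
move=> nm; have : kermx M != 0.
  rewrite -mxrank_eq0 mxrank_ker subn_eq0 -ltnNge.
  exact: leq_ltn_trans (rank_leq_col M) nm.
case/rowV0Pn => v vM v0; exists v => //; exact/sub_kermxP.
Qed.

Section DepthBound.
Variables (K : fieldType) (s : nat).
Local Notation S := {mpoly K[s]}.
Implicit Types (f g p q : S) (m : 'X_{1..s}) (C : {set 'I_s}).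

Lemma mcoeffM_neq0 p q m : (p * q)@_m != 0 ->
  exists m1 m2, [/\ p@_m1 != 0, q@_m2 != 0 & m = (m1 + m2)%MM].
Proof.
rewrite -mcoeff_msupp => /msuppM_le/allpairsP[[m1 m2] /= []].
by rewrite !mcoeff_msupp => ? ? ->; exists m1, m2.
Qed.

Definition degle B p := forall m, p@_m != 0 -> (mdeg m <= B)%N.

Lemma degle1 B : degle B 1.
Proof.
by move=> m; rewrite mcoeff1; case: (eqVneq m 0%MM) => [->|_]; rewrite ?mdeg0 ?eqxx.
Qed.

Lemma degleM B B' p q : degle B p -> degle B' q -> degle (B + B') (p * q).
Proof.
move=> Hp Hq m /mcoeffM_neq0[m1 [m2 [/Hp ? /Hq ? ->]]].
by rewrite mdegD leq_add.
Qed.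

Lemma degleX B p n : degle B p -> degle (n * B) (p ^+ n).
Proof.
by move=> Hp; elim: n => [|n IH]; [exact: degle1 | rewrite exprS mulSn; exact: degleM].
Qed.

Lemma degleW B B' p : (B <= B')%N -> degle B p -> degle B' p.
Proof. by move=> BB' Hp m /Hp H; exact: leq_trans H BB'. Qed.

Lemma degle_power_prod D E (fs : seq S) (b : expvec D (size fs)) :
  (forall f, f \in fs -> degle E f) -> degle (size fs * (D * E)) (power_prod b).
Proof.
elim: fs b => [|f fs IH] /= b H; first exact: degle1.
rewrite mulSn; apply: degleM.
  apply: (@degleW (b.1 * E)%N); first by rewrite leq_mul2r (ltnW (ltn_ord _)) orbT.
  by apply/degleX/H; rewrite mem_head.
by apply: IH => g gfs; apply: H; rewrite inE gfs orbT.
Qed.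

Lemma degle_seq (fs : seq S) : exists E, forall f, f \in fs -> degle E f.
Proof.
exists (\max_(f <- fs) msize f)%N => f ffs m; rewrite -mcoeff_msupp.
move/msize_mdeg_lt/ltnW => H; apply: leq_trans H _.
by rewrite (big_rem f) //= leq_maxl.
Qed.

(** Dimension count: the [D ^ size fs] products with exponents below [D] lie,
    modulo [linprime C], in the span of the monomials of degree at most a
    constant times [D] in the variables outside [C], and the number of these
    grows like [D ^ #|~: C|]. *)
Lemma size_free_le C (fs : seq S) :
  (forall D (c : expvec D (size fs) -> K),
     \sum_b c b *: power_prod b \in linprime K C -> forall b, c b = 0) ->
  (size fs <= #|~: C|)%N.
Proof.
move=> free; have [E HE] := degle_seq fs.
set k := size fs in free *; set m := #|~: C|.
(* D only has to beat the factor (k * E).+1 ^ m between the two counts *)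
pose D := ((k * E).+1 ^ m).+1; pose B := (k * (D * E))%N.
pose T := pffun_on (ord0 : 'I_B.+1) (mem (~: C)) (predT : pred 'I_B.+1).
have cardT : #|T| = (B.+1 ^ m)%N by rewrite card_pffun_on card_ord.
pose mon (g : {ffun 'I_s -> 'I_B.+1}) : 'X_{1..s} := [multinom (g i : nat) | i < s].
pose M := \matrix_(i < #|{: expvec D k}|, j < #|T|)
  (power_prod (enum_val i))@_(mon (enum_val j)).
have [|cols_rows] := leqP #|{: expvec D k}| #|T|.
  rewrite card_expvec cardT => H; rewrite leqNgt; apply/negP => mk.
  have : (D ^ m.+1 <= D ^ m * (k * E).+1 ^ m)%N.
    apply: leq_trans (leq_trans H _); first by rewrite leq_pexp2l.
    rewrite -expnMn; have le : (B.+1 <= D * (k * E).+1)%N.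
      by rewrite /B mulnS mulnCA -addn1 addnC leq_add2r.
    by case: (m) => // m'; rewrite leq_exp2r.
  by rewrite expnSr leq_pmul2l ?expn_gt0 // /D ltnn.
have [v v0 vM] := exists_left_kernel M cols_rows.
case/negP: v0; apply/eqP/rowP => i; rewrite mxE.
pose c b := v 0 (enum_rank b).
suff /free/(_ (enum_val i)) : \sum_b c b *: power_prod b \in linprime K C.
  by rewrite /c enum_valK.
apply/linprimeP => m'; apply: contraNN => avm'.
rewrite (raddf_sum (mcoeff m')) /=.
have [Bm'|m'B] := ltnP B (mdeg m').
  rewrite big1 // => b _; rewrite mcoeffZ.
  have [->|/(degle_power_prod HE)] := eqVneq ((power_prod b)@_m') 0.
    by rewrite mulr0.
  by rewrite leqNgt Bm'.
pose g : {ffun 'I_s -> 'I_B.+1} := [ffun i => inord (m' i)].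
have m'iB j : (m' j < B.+1)%N.
  by rewrite ltnS (leq_trans _ m'B) // mdegE (bigD1 j) //= leq_addr.
have gT : g \in T.
  apply/pffun_onP; split=> [|y _]; last by [].
  apply/supportP => j; rewrite inE negbK => jC; rewrite ffunE.
  by rewrite (avoidsP _ _ avm') //; apply/val_inj; rewrite /= inordK.
have mong : mon g = m' by apply/mnmP => j; rewrite mnmE ffunE inordK.
have := congr1 (fun w : 'rV_ _ => w 0 (enum_rank_in gT g)) vM.
rewrite !mxE => E0; apply/eqP; rewrite -[RHS]E0.
rewrite (reindex (@enum_val (expvec D k) predT)) /=; last first.
  by exists enum_rank => x _; rewrite ?enum_valK ?enum_rankK.
apply: eq_bigr => j _; rewrite mcoeffZ mxE enum_rankK_in // mong /c.
by rewrite enum_valK.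
Qed.

Lemma mcoeffX_irrelevant f n m :
  f \in @irrelevant K s -> (f ^+ n)@_m != 0 -> (n <= mdeg m)%N.
Proof.
move=> /eqP f0; elim: n m => // n IH m.
rewrite exprS => /mcoeffM_neq0[m1 [m2 [fm1 /IH le ->]]].
rewrite mdegD -add1n leq_add // lt0n mdeg_eq0; apply: contraNneq fm1 => ->.
by rewrite f0.
Qed.

(** The classical bound of the depth of S/J by the dimension of an associated
    prime, for a prime [linprime C] annihilating the class of the monomial [u].
    Replace the sequence by powers of degree above that of [u], which cannot
    generate [u] modulo J.  Their products, multiplied by [u], are independent
    modulo J; hence the products themselves are independent modulo the
    annihilator of [u]. *)
Lemma depth_le_annihilator (A : {pred S}) C (u : 'X_{1..s}) (fs : seq S) :
  (forall f, f \in linprime K C -> f * 'X_[u] \in ideal_gen A) ->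
  (forall f m, f \in ideal_gen A -> (m <= u)%MM -> f@_m = 0) ->
  {subset fs <= @irrelevant K s} -> regular_seq (ideal_gen A) fs ->
  (size fs <= #|~: C|)%N.
Proof.
move=> annu Au fsm /regular_seq_regular reg.
pose gs := [seq f ^+ (mdeg u).+1 | f <- fs].
have -> : size fs = size gs by rewrite size_map.
have HJ := @ideal_gen_isideal _ A.
apply: size_free_le => D c Hc.
apply: (@power_prod_free _ _ D (fun f => f \in ideal_gen A) gs 'X_[u]) => //.
- exact: regular_expr.
(* Q contains J and the powers, but not u *)
- pose Q f := forall m, (m <= u)%MM -> f@_m = 0.
  have QI : isideal Q.
    split=> [m _|a x y Qx Qy m mu]; first exact: mcoeff0.
    rewrite mcoeffD Qy // addr0; apply/eqP/negPn/negP.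
    move=> /mcoeffM_neq0[m1 [m2 [_ xm2 E]]]; case/negP: xm2; apply/eqP/Qx.
    by apply: lepm_trans mu; rewrite E; exact: lem_addl.
  move=> uJ; have : Q 'X_[u].
    apply: (adjs_min QI _ _ uJ).
      by move=> g gA m; exact: Au.
    move=> x /mapP[f /fsm fm ->] m mu; apply/eqP/negPn/negP.
    move/(mcoeffX_irrelevant fm); rewrite leqNgt ltnS -(submK mu) mdegD.
    by rewrite leq_addl.
  by move/(_ u (lepm_refl u))/eqP; rewrite mcoeffX eqxx oner_eq0.
- exact: annu.
Qed.

End DepthBound.

(** * Edge ideals and maximal independent sets *)

Section EdgeIdeals.
Variables (K : fieldType) (s : nat).
Local Notation S := {mpoly K[s]}.
Implicit Types (f g p q : S) (m : 'X_{1..s}) (A C : {set 'I_s}) (J : {pred S}).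

Lemma avoidsC A m : avoids (~: A) m = (mvars m \subset A).
Proof. by rewrite /avoids disjoints_subset setCK. Qed.

Lemma mvars_mesym1 A : mvars (mesym1 A) = A.
Proof. by apply/setP => i; rewrite inE mnmE eqb0 negbK. Qed.

Lemma mvarsD m1 m2 : mvars (m1 + m2) = mvars m1 :|: mvars m2.
Proof. by apply/setP => i; rewrite !inE mnmDE addn_eq0 negb_and. Qed.

Lemma mvarsS m1 m2 : (m1 <= m2)%MM -> mvars m1 \subset mvars m2.
Proof. by move/submK <-; rewrite mvarsD subsetUr. Qed.

(** Removing the variables of [A] from [~: A] one at a time gives a chain of
    linear primes. *)
Lemma linprime_chain J A : {subset J <= linprime K (~: A)} -> prime_chain J #|A|.
Proof.
move=> JA; pose C i := ~: [set x in drop i (enum A)].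
exists (fun i => linprime K (C i)); split=> [i _|i iA].
  split; [exact: linprime_closed | exact: linprime_prime |].
  move=> f /JA; apply: linprimeS; rewrite setCS; apply/subsetP => x.
  by rewrite inE => /mem_drop; rewrite mem_enum.
have Es : (i < size (enum A))%N by rewrite -cardE.
split.
  apply: linprimeS; rewrite setCS; apply/subsetP => x; rewrite !inE => xd.
  by apply: (mem_drop (n0 := 1)); rewrite drop_drop add1n.
have [x0 _] : exists x, x \in A by apply/set0Pn; rewrite -card_gt0 (leq_trans _ iA).
pose x := nth x0 (enum A) i.
have dE : drop i (enum A) = x :: drop i.+1 (enum A) by rewrite -drop_nth.
have xn : x \notin drop i.+1 (enum A).
  have : uniq (drop i (enum A)) by rewrite drop_uniq ?enum_uniq.
  by rewrite dE /= => /andP[].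
move/(_ 'X_x); rewrite !linprimeX => H.
have /H/negP : ~~ avoids (C i.+1) U_(x).
  by apply/negP => /avoidsP/(_ x); rewrite !inE mnm1E eqxx => /(_ xn).
apply; apply/avoidsP => y; rewrite !inE dE inE mnm1E => yC.
by apply/eqP; rewrite eqb0; apply: contraNneq yC => ->; rewrite eqxx.
Qed.

Variable G : rel 'I_s.
Hypothesis G_irrefl : irreflexive G.

Definition indep A := [forall i in A, forall j in A, ~~ G i j].

Lemma indepP A : reflect {in A &, forall i j, ~~ G i j} (indep A).
Proof.
apply: (iffP forall_inP) => [H i j iA jA|H i iA].
  exact: (forall_inP (H i iA)).
by apply/forall_inP => j jA; apply: H.
Qed.

Lemma indepS A A' : A \subset A' -> indep A' -> indep A.
Proof.
move=> /subsetP AA' /indepP H; apply/indepP => i j iA jA.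
by apply: H; exact: AA'.
Qed.

Lemma edge_idealP f : f \in edge_ideal K G <->
  forall m, f@_m != 0 -> ~~ indep (mvars m).
Proof.
pose D (a : 'X_{1..s}) := exists i j, G i j /\ a = (U_(i) + U_(j))%MM.
have H1 f' : f' \in [pred f | [exists i, exists j, G i j && (f == 'X_i * 'X_j)]] ->
    exists2 a, f' = 'X_[K, a] & D a.
  rewrite inE => /existsP[i /existsP[j /andP[ij /eqP->]]].
  by exists (U_(i) + U_(j))%MM; [rewrite mpolyXD | exists i, j].
have H2 a : D a ->
    'X_[K, a] \in [pred f : S | [exists i, exists j, G i j && (f == 'X_i * 'X_j)]].
  case=> i [j [ij ->]]; rewrite inE; apply/existsP; exists i; apply/existsP.
  by exists j; rewrite ij mpolyXD eqxx.
have := monomial_idealP H1 H2 f; rewrite -/(edge_ideal K G) => ->.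
have E m : (exists2 a, D a & (a <= m)%MM) <-> ~~ indep (mvars m).
  split=> [[a [i [j [ij ->]]] le]|].
    have := mvarsS le; rewrite mvarsD => /subsetP sub.
    have im : i \in mvars m by apply: sub; rewrite !inE mnm1E eqxx.
    have jm : j \in mvars m by apply: sub; rewrite !inE !mnm1E eqxx orbT.
    by apply/negP => /indepP/(_ i j im jm); rewrite ij.
  case/forall_inPn => i; rewrite inE => im /forall_inPn[j]; rewrite inE => jm.
  rewrite negbK => ij; exists (U_(i) + U_(j))%MM; first by exists i, j.
  apply/mnm_lepP => k; rewrite mnmDE !mnm1E.
  have ji : j == i = false by apply/negP => /eqP E; rewrite E G_irrefl in ij.
  case: (eqVneq i k) => [<-|_]; first by rewrite ji addn0 lt0n.
  by case: (eqVneq j k) => [<-|_] //; rewrite add0n lt0n.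
by split=> H m /H/E.
Qed.

Lemma edge_ideal_linprime A : indep A ->
  {subset edge_ideal K G <= linprime K (~: A)}.
Proof.
move=> iA f /edge_idealP H; apply/linprimeP => m /H; apply: contra.
by rewrite avoidsC => mA; exact: indepS iA.
Qed.

(** The complements of these sets are the minimal vertex covers, so they index
    the minimal primes of the edge ideal. *)
Definition maxindep A := maxset indep A.

(** The edge ideal is the intersection of its minimal primes: the support of a
    monomial outside it extends to a maximal independent set. *)
Lemma notin_edge_ideal f : f \notin edge_ideal K G ->
  exists2 A, maxindep A & f \notin linprime K (~: A).
Proof.
move=> fI; have [m [fm im]] : exists m, f@_m != 0 /\ indep (mvars m).
  apply: contrapT => H; case/negP: fI; apply/edge_idealP => m fm.
  by apply/negP => im; apply: H; exists m.
have [A mA sub] := maxset_exists im; exists A => //.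
apply/negP => /linprimeP/(_ m fm); by rewrite avoidsC sub.
Qed.

Lemma maxindep_add A i : maxindep A -> i \notin A -> ~~ indep (i |: A).
Proof.
case/maxsetP => _ max iA; apply/negP => /max/(_ (subsetUr _ _)) E.
by case/negP: iA; rewrite -E setU11.
Qed.

(** Multiplying the product of the vertices in [A] by another vertex gives a
    multiple of an edge; so the minimal prime of [A] is an associated prime. *)
Lemma linprime_mul_mesym1 A f : maxindep A ->
  f \in linprime K (~: A) -> f * 'X_[mesym1 A] \in edge_ideal K G.
Proof.
move=> mA /linprimeP fA; apply/edge_idealP => m.
case/mcoeffM_neq0 => m1 [m2 [/fA]].
rewrite mcoeffX avoidsC => /subsetPn[i im1 iA] h ->.
have {h}<- : mesym1 A = m2.
  by move: h; case: (eqVneq (mesym1 A) m2) => // _; rewrite eqxx.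
apply: contra (maxindep_add mA iA); apply: indepS.
by rewrite mvarsD mvars_mesym1 setSU // sub1set.
Qed.

(** Unmixedness: the Krull dimension is at least, and the depth at most, the
    dimension [#|A|] of S modulo the minimal prime of [A]. *)
Lemma cohen_macaulay_maxindep k A :
  has_krull_dim (edge_ideal K G) k -> has_depth (edge_ideal K G) k ->
  maxindep A -> #|A| = k.
Proof.
move=> [_ dim] [[fs [fk fsm reg]] _] mA.
have [iA _] := maxsetP mA.
apply/eqP; rewrite eqn_leq dim; last first.
  exact/linprime_chain/edge_ideal_linprime.
rewrite -fk -[A]setCK; apply: (depth_le_annihilator (u := mesym1 A)) fsm reg.
  by move=> f; apply: linprime_mul_mesym1.
move=> f m /edge_idealP H mu; apply/eqP; apply: contraT => /H/negP[].
by apply: indepS iA; rewrite -[A]mvars_mesym1 mvarsS.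
Qed.

End EdgeIdeals.

(** * Hilbert functions *)

Section QuotientDimension.
Variables (K : fieldType) (E : lmodType K).

Lemma quot_dim_max (V W : {pred E}) n l (v : 'I_l -> E) :
  0 \in W -> (forall a, {in W &, forall x y, a *: x + y \in W}) ->
  has_quot_dim V W n -> (forall j, v j \in V) ->
  (forall c : 'I_l -> K, \sum_j c j *: v j \in W -> forall j, c j = 0) ->
  (l <= n)%N.
Proof.
move=> W0 WZD [b [_ _ span]] vV free; rewrite leqNgt; apply/negP => nl.
pose cf j := projT1 (cid (span _ (vV j))).
have cfP j : v j - \sum_i cf j i *: b i \in W by exact: projT2 (cid (span _ (vV j))).
have [w w0 wM] := exists_left_kernel (\matrix_(j, i) cf j i) nl.
case/negP: w0; apply/eqP/rowP => j; rewrite mxE; move: j.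
apply: free.
have -> : \sum_j w 0 j *: v j = \sum_j w 0 j *: (v j - \sum_i cf j i *: b i).
  rewrite [RHS](eq_bigr (fun j => w 0 j *: v j - \sum_i (w 0 j * cf j i) *: b i)).
    rewrite sumrB exchange_big /= [X in _ - X]big1 ?subr0 // => i _.
    rewrite -scaler_suml; have := congr1 (fun u : 'rV_n => u 0 i) wM.
    rewrite !mxE => E0; rewrite (eq_bigr (fun j => w 0 j * (\matrix_(j, i) cf j i) j i)).
      by rewrite E0 scale0r.
    by move=> j _; rewrite mxE.
  move=> j _; rewrite scalerBr scaler_sumr; congr (_ - _).
  by apply: eq_bigr => i _; rewrite scalerA.
by elim/big_rec: _ => // j x _ xW; apply: WZD.
Qed.

End QuotientDimension.

Section CountMonomials.
Variable s : nat.
Implicit Types (m : 'X_{1..s}) (P Q : pred 'X_{1..s}) (A : {set 'I_s}).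

Definition degmons (n : nat) : seq 'X_{1..s} :=
  [seq m <- map (@bmnm s n.+1) (enum {: 'X_{1..s < n.+1}}) | mdeg m == n].

Lemma mem_degmons n m : (m \in degmons n) = (mdeg m == n).
Proof.
rewrite mem_filter; case: eqP => //= E.
have lt : (mdeg m < n.+1)%N by rewrite E.
by apply/mapP; exists (BMultinom lt); rewrite ?mem_enum.
Qed.

Lemma degmons_uniq n : uniq (degmons n).
Proof.
by apply: filter_uniq; rewrite map_inj_uniq ?enum_uniq //; exact: val_inj.
Qed.

Lemma filter_degmons_uniq P n : uniq [seq m <- degmons n | P m].
Proof. exact/filter_uniq/degmons_uniq. Qed.

Definition cntmons P n := count P (degmons n).

Lemma cntmonsE P n : cntmons P n = (\sum_(m <- degmons n) P m)%N.
Proof. by rewrite /cntmons -sum1_count big_mkcond; apply: eq_bigr => m; case: (P m). Qed.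

Lemma leq_cntmons P Q n n' (h : 'X_{1..s} -> 'X_{1..s}) :
  {in P &, injective h} ->
  (forall m, P m -> mdeg m = n -> Q (h m) /\ mdeg (h m) = n') ->
  (cntmons P n <= cntmons Q n')%N.
Proof.
move=> inj H; rewrite /cntmons -!size_filter -(size_map h).
apply: uniq_leq_size.
  rewrite map_inj_in_uniq ?filter_degmons_uniq // => x y.
  by rewrite !mem_filter => /andP[Px _] /andP[Py _]; apply: inj.
move=> m' /mapP[m]; rewrite mem_filter mem_degmons => /andP[Pm /eqP dm] ->.
by rewrite mem_filter mem_degmons; have [-> ->] := H m Pm dm; rewrite eqxx.
Qed.

(** Exponent vectors supported on [A] are compositions of [n] into [q.+1] parts
    with zeros allowed. *)
Lemma cntmons_support A q n : #|A| = q.+1 ->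
  cntmons (fun m => mvars m \subset A) n = 'C(q + n, q).
Proof.
move=> cA; pose e (j : 'I_q.+1) := enum_val (cast_ord (esym cA) j).
have e_inj : injective e by move=> i j /enum_val_inj/cast_ord_inj.
have eA j : e j \in A by apply: enum_valP.
have Ae i : i \in A -> exists j, i = e j.
  move=> iA; exists (cast_ord cA (enum_rank_in iA i)).
  by rewrite /e cast_ordK enum_rankK_in.
pose g (t : q.+1.-tuple 'I_n.+1) : 'X_{1..s} :=
  [multinom (\sum_(j | e j == i) tnth t j)%N | i < s].
have ge t j : g t (e j) = tnth t j.
  rewrite mnmE (big_pred1 j) // => j'; exact: inj_eq.
have gdeg t : mdeg (g t) = (\sum_(x <- t) x)%N.
  rewrite mdegE big_tuple (partition_big e predT) //=.
  by apply: eq_bigr => i _; rewrite mnmE.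
have ginj : injective g.
  by move=> t t' gt; apply: eq_from_tnth => j; apply/val_inj; rewrite /= -!ge gt.
rewrite -card_ord_partitions cardE -(size_map g) /cntmons -size_filter.
apply/perm_size/uniq_perm; rewrite ?filter_degmons_uniq //.
  by rewrite map_inj_uniq // enum_uniq.
move=> m; rewrite mem_filter mem_degmons; apply/andP/mapP.
  case=> /subsetP mA /eqP dm.
  pose t := [tuple (inord (m (e j)) : 'I_n.+1) | j < q.+1].
  have mg : m = g t.
    apply/mnmP => i; have [iA|iA] := boolP (i \in A).
      have [j ->] := Ae i iA; rewrite ge tnth_mktuple inordK // ltnS -dm.
      by rewrite mdegE (bigD1 (e j)) //= leq_addr.
    rewrite mnmE big1 => [|j /eqP ej].
      by apply/eqP; apply: contraNT iA => mi; apply: mA; rewrite inE.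
    by rewrite -ej eA in iA.
  by exists t => //; rewrite mem_enum inE -gdeg -mg dm.
case=> t; rewrite mem_enum inE => /eqP dt ->; rewrite gdeg dt; split=> //.
apply/subsetP => i; rewrite inE; apply: contraR => iA.
rewrite mnmE big1 // => j /eqP ej; by rewrite -ej eA in iA.
Qed.

(** Multiply by the product of the variables in [A]. *)
Lemma cntmons_full_support A n :
  (cntmons (fun m => mvars m \subset A) n <=
   cntmons (fun m => mvars m == A) (n + #|A|))%N.
Proof.
apply: (leq_cntmons (h := fun m => (m + mesym1 A)%MM)).
  by move=> m m' _ _ /addIm.
move=> m mA dm; rewrite mvarsD mvars_mesym1 mdegD mdeg_mesym1 dm.
by split=> //; apply/eqP/setUidPr.
Qed.

Variables (G : rel 'I_s) (q : nat).
Hypothesis unmixed : forall A, maxindep G A -> #|A| = q.+1.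

Definition nfacets := #|[set A | maxindep G A]|.

Definition cntindep := cntmons (fun m => indep G (mvars m)).

(** Every independent set extends to a maximal one. *)
Lemma cntindep_le n : (cntindep n <= nfacets * 'C(q + n, q))%N.
Proof.
rewrite /nfacets -sum_nat_const.
rewrite (eq_bigr (fun A => cntmons (fun m => mvars m \subset A) n)); last first.
  by move=> A; rewrite inE => /unmixed cA; rewrite (cntmons_support n cA).
rewrite /cntindep cntmonsE (eq_bigr _ (fun A _ => cntmonsE _ n)) exchange_big /=.
apply: leq_sum => m _; case: (boolP (indep _ _)) => // im.
have [A mA sub] := maxset_exists im.
by rewrite (bigD1 A) ?inE //= sub.
Qed.

(** Unlike the monomials supported inside maximal independent sets, those whose
    support is exactly such a set are counted once. *)
Lemma cntindep_ge n : (nfacets * 'C(q + n, q) <= cntindep (n + q.+1))%N.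
Proof.
rewrite /nfacets -sum_nat_const.
apply: (@leq_trans (\sum_(A in [set A | maxindep G A])
           cntmons (fun m => mvars m == A) (n + q.+1))).
  apply: leq_sum => A; rewrite inE => /unmixed cA.
  by rewrite -(cntmons_support n cA) -cA cntmons_full_support.
rewrite /cntindep cntmonsE (eq_bigr _ (fun A _ => cntmonsE _ _)) exchange_big /=.
apply: leq_sum => m _; have [mM|mM] := boolP (mvars m \in [set A | maxindep G A]).
  rewrite (bigD1 (mvars m)) //= eqxx big1 ?addn0.
    by move: mM; rewrite inE => /maxsetP[->].
  by move=> A /andP[_ /negbTE]; rewrite eq_sym => ->.
by rewrite big1 // => A AM; case: eqP => // E; rewrite E AM in mM.
Qed.

End CountMonomials.

Section HilbertFunctions.
Variables (K : fieldType) (s : nat).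
Local Notation S := {mpoly K[s]}.
Implicit Types (f g : S) (m : 'X_{1..s}) (P : pred 'X_{1..s}).

Lemma monomials_free n (c : 'I_n -> K) (h : 'I_n -> 'X_{1..s}) i :
  injective h -> (\sum_j c j *: 'X_[K, h j])@_(h i) = c i.
Proof.
move=> inj; rewrite (raddf_sum (mcoeff (h i))) (bigD1 i) //= big1 => [|j ji].
  by rewrite mcoeffZ mcoeffX eqxx mulr1 addr0.
by rewrite mcoeffZ mcoeffX (inj_eq inj) (negbTE ji) mulr0.
Qed.

Definition monseq (P : pred 'X_{1..s}) n := [seq m <- degmons s n | P m].

Definition nthmon P n (i : 'I_(cntmons P n)) : 'X_{1..s} := nth 0%MM (monseq P n) i.

Lemma nthmonP P n i : P (@nthmon P n i) /\ mdeg (@nthmon P n i) = n.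
Proof.
have : @nthmon P n i \in monseq P n by rewrite mem_nth // size_filter.
by rewrite mem_filter mem_degmons => /andP[? /eqP].
Qed.

Lemma nthmon_inj P n : injective (@nthmon P n).
Proof.
move=> i j /eqP; rewrite nth_uniq ?size_filter ?filter_degmons_uniq //.
by move/eqP/val_inj.
Qed.

Lemma nthmon_surj P n m : P m -> mdeg m = n -> exists i, m = @nthmon P n i.
Proof.
move=> Pm dm; have mM : m \in monseq P n by rewrite mem_filter Pm mem_degmons dm /=.
have lt : (index m (monseq P n) < cntmons P n)%N.
  by rewrite /cntmons -size_filter index_mem.
by exists (Ordinal lt); rewrite /nthmon nth_index.
Qed.

(** Reduction modulo a monomial ideal just drops the monomials in it, so the
    other ones are a basis of the quotient. *)
Lemma hilbert_monomial (J : {pred S}) (P : pred 'X_{1..s}) :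
  (forall f, f \in J <-> forall m, f@_m != 0 -> ~~ P m) ->
  has_hilbert_function J (cntmons P).
Proof.
move=> HJ n; exists (fun i => 'X_[@nthmon P n i]); split.
- by move=> i; rewrite inE dhomogX; apply/eqP; case: (nthmonP i).
- move=> c; rewrite inE => /andP[_ /HJ H] i; apply/eqP/negPn/negP => ci.
  have := H (nthmon i); rewrite (monomials_free _ _ (@nthmon_inj P n)).
  by move/(_ ci)/negP; apply; case: (nthmonP i).
- move=> v vn; exists (fun i => v@_(nthmon i)); rewrite inE /=; apply/andP; split.
    rewrite inE rpredB //; apply: rpred_sum => i _; apply: rpredZ.
    by rewrite dhomogX; apply/eqP; case: (nthmonP i).
  apply/HJ => m; apply: contra => Pm; rewrite mcoeffB subr_eq0.
  have [vm|vm] := eqVneq (v@_m) 0.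
    rewrite vm eq_sym (raddf_sum (mcoeff m)) big1 //= => i _.
    rewrite mcoeffZ mcoeffX; case: (eqVneq (nthmon i) m) => [->|_].
      by rewrite vm mul0r.
    by rewrite mulr0.
  have dm : mdeg m = n.
    move: vn; rewrite inE => /dhomogP; apply; by rewrite mcoeff_msupp.
  have [i ->] := nthmon_surj Pm dm.
  by rewrite (monomials_free _ _ (@nthmon_inj P n)).
Qed.

(** Multiplication by [f] embeds the polynomials in the variables outside [C]
    into the kernel of S/J -> S/(J, f). *)
Lemma hilbert_add_form (A : {pred S}) (f : S) (C : {set 'I_s}) d n H N :
  let J := ideal_gen A in
  {subset J <= linprime K C} -> f \notin linprime K C -> f \is d.-homog ->
  (d <= n)%N ->
  has_quot_dim (@graded_part K s n) [predI @graded_part K s n & J] N ->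
  has_quot_dim (@graded_part K s n)
    [predI @graded_part K s n & ideal_gen [predU1 f & J]] H ->
  (H + cntmons (fun m => mvars m \subset ~: C) (n - d) <= N)%N.
Proof.
move=> J JC fC fd dn dimN [b [bn bfree _]].
set P := fun m => _; set W := cntmons P _.
have Jf g : g \in J -> g \in ideal_gen [predU1 f & J].
  by move=> gJ; apply: mem_ideal_gen; rewrite !inE gJ orbT.
pose mon (j : 'I_W) := 'X_[K, @nthmon P (n - d) j].
pose v (i : 'I_(H + W)) := match split i with inl i' => b i' | inr j => mon j * f end.
have vl i : v (lshift W i) = b i by rewrite /v (unsplitK (inl i)).
have vr j : v (rshift H j) = mon j * f by rewrite /v (unsplitK (inr j)).
have vV i : v i \in @graded_part K s n.
  rewrite /v; case: split => [i'|j]; first exact: bn.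
  rewrite inE -(subnK dn); apply: dhomogM => //.
  by rewrite dhomogX; apply/eqP; case: (nthmonP j).
apply: (quot_dim_max _ _ dimN vV).
- by rewrite !inE dhomog0 ideal_gen0.
- move=> a x y /andP[xn xJ] /andP[yn yJ]; apply/andP; split.
    by move: xn yn; rewrite !inE => xn yn; rewrite rpredD ?rpredZ.
  by rewrite /= ideal_genD // -mul_mpolyC ideal_genM.
move=> c; rewrite big_split_ord /= inE.
rewrite (eq_bigr _ (fun i _ => congr1 _ (vl i))).
rewrite [X in _ + X](eq_bigr (fun j => (c (rshift H j) *: mon j) * f)); last first.
  by move=> j _; rewrite vr scalerAl.
rewrite -mulr_suml => /andP[_] /=.
set g := \sum_(j < W) _ => sumJ.
have cl i : c (lshift W i) = 0.
  apply: (bfree (fun i => c (lshift W i))); rewrite inE; apply/andP; split.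
    by apply: rpred_sum => i' _; apply: rpredZ; exact: bn.
  rewrite /= -[X in X \in _](addrK (g * f)); apply: ideal_genB; first exact: Jf.
  by apply: ideal_genM; apply: mem_ideal_gen; rewrite !inE eqxx.
have gC : g \in linprime K C.
  move: sumJ; rewrite big1 ?add0r => [/JC|i _]; last by rewrite cl scale0r.
  by rewrite linprimeM (negbTE fC) orbF.
have cr j : c (rshift H j) = 0.
  apply/eqP/negPn/negP => cj; move/linprimeP: gC => /(_ (nthmon j)).
  rewrite (monomials_free (fun j => c (rshift H j))); last exact: nthmon_inj.
  move/(_ cj)/negP; apply; rewrite -[C]setCK avoidsC.
  by case: (nthmonP j).
by move=> i; case: (split_ordP i) => j ->.
Qed.

End HilbertFunctions.

(** * Limits of rational sequences *)

Section RationalLimits.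
Implicit Types (u v w : nat -> rat) (l : rat).

Lemma rat_cvg_near u v l : (exists N, forall n, (N <= n)%N -> u n = v n) ->
  rat_cvg u l -> rat_cvg v l.
Proof.
move=> [N E] H eps /H[N' H']; exists (maxn N N') => n.
by rewrite geq_max => /andP[/E <- /H'].
Qed.

Lemma rat_cvg_cst l : rat_cvg (fun=> l) l.
Proof. by move=> eps e0; exists 0%N => n _; rewrite subrr normr0. Qed.

Lemma rat_cvgD u v l l' :
  rat_cvg u l -> rat_cvg v l' -> rat_cvg (fun n => u n + v n) (l + l').
Proof.
move=> Hu Hv eps e0; have e2 : 0 < eps / 2 by rewrite divr_gt0.
have [N HN] := Hu _ e2; have [N' HN'] := Hv _ e2.
exists (maxn N N') => n; rewrite geq_max => /andP[/HN A /HN' B].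
rewrite opprD addrACA (le_lt_trans (ler_normD _ _)) //.
by rewrite [eps]splitr ltrD.
Qed.

Lemma rat_cvgM u v l l' :
  rat_cvg u l -> rat_cvg v l' -> rat_cvg (fun n => u n * v n) (l * l').
Proof.
move=> Hu Hv eps e0.
pose M := `|l| + `|l'| + 1.
have M0 : 0 < M by rewrite /M; have := normr_ge0 l; have := normr_ge0 l'; lra.
pose d := Num.min 1 (eps / (2 * M)).
have d0 : 0 < d by rewrite lt_min ltr01 divr_gt0 // mulr_gt0.
have dM : d * M <= eps / 2.
  apply: (@le_trans _ _ (eps / (2 * M) * M)).
    by rewrite ler_wpM2r ?(ltW M0) // ge_min lexx orbT.
  by rewrite invfM mulrA -mulrA mulVf ?gt_eqF // mulr1.
have d1 : d <= 1 by rewrite ge_min lexx.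
have [N HN] := Hu _ d0; have [N' HN'] := Hv _ d0.
exists (maxn N N') => n; rewrite geq_max => /andP[/HN A /HN' B].
have -> : u n * v n - l * l' =
    (u n - l) * (v n - l') + (u n - l) * l' + l * (v n - l') by ring.
apply: (@le_lt_trans _ _ (d * `|v n - l'| + d * `|l'| + `|l| * d)).
  rewrite (le_trans (ler_normD _ _)) // lerD //; last first.
    by rewrite normrM ler_wpM2l // ltW.
  rewrite (le_trans (ler_normD _ _)) // !normrM lerD //.
    by rewrite ler_wpM2r // ltW.
  by rewrite ler_wpM2r // ltW.
apply: (@le_lt_trans _ _ (d * M)); last by lra.
rewrite [`|l| * d]mulrC -!mulrDr ler_wpM2l ?(ltW d0) // /M.
have := ltW B; lra.
Qed.

Lemma rat_cvgX u l q : rat_cvg u l -> rat_cvg (fun n => u n ^+ q) (l ^+ q).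
Proof.
move=> Hu; elim: q => [|q IH].
  by rewrite expr0; apply: (rat_cvg_near _ (@rat_cvg_cst 1)); exists 0%N.
rewrite exprS; apply: (rat_cvg_near _ (rat_cvgM Hu IH)); exists 0%N => n _.
by rewrite exprS.
Qed.

Lemma rat_squeeze u v w l :
  (exists N, forall n, (N <= n)%N -> u n <= v n <= w n) ->
  rat_cvg u l -> rat_cvg w l -> rat_cvg v l.
Proof.
move=> [N E] Hu Hw eps e0; have [N1 H1] := Hu _ e0; have [N2 H2] := Hw _ e0.
exists (maxn N (maxn N1 N2)) => n; rewrite !geq_max => /and3P[/E/andP[uv vw] /H1 A /H2 B].
move: A B; rewrite !ltr_norml => /andP[A _] /andP[_ B].
by apply/andP; split; lra.
Qed.

Lemma rat_cvg_le u v l l' : (exists N, forall n, (N <= n)%N -> u n <= v n) ->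
  rat_cvg u l -> rat_cvg v l' -> l <= l'.
Proof.
move=> [N E] Hu Hv; rewrite leNgt; apply/negP => ll.
have e0 : 0 < (l - l') / 2 by lra.
have [N1 H1] := Hu _ e0; have [N2 H2] := Hv _ e0.
have := E (maxn N (maxn N1 N2)) (leq_maxl _ _).
have := H1 (maxn N (maxn N1 N2)).
have := H2 (maxn N (maxn N1 N2)).
rewrite !leq_max !leqnn !orbT => /(_ isT) B /(_ isT) A; move: A B.
rewrite !ltr_norml => /andP[A _] /andP[_ B]; lra.
Qed.

Lemma rat_cvg_harmonic (c : rat) : rat_cvg (fun n => c / n%:R) 0.
Proof.
move=> eps e0; exists (Num.bound (`|c| / eps)).+1 => n nN.
have n0 : 0 < n%:R :> rat by rewrite ltr0n (leq_trans _ nN).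
rewrite subr0 normrM normfV (gtr0_norm n0) ltr_pdivrMr // mulrC -ltr_pdivrMr //.
apply: (lt_le_trans (archi_boundP _)); first by rewrite divr_ge0 // ltW.
by rewrite ler_nat ltnW.
Qed.

Lemma rat_cvg_shift_ratio (c : rat) q : rat_cvg (fun n => ((n%:R + c) / n%:R) ^+ q) 1.
Proof.
have H := rat_cvgD (rat_cvg_cst 1) (rat_cvg_harmonic c); rewrite addr0 in H.
suff /(rat_cvgX q) : rat_cvg (fun n => (n%:R + c) / n%:R) 1 by rewrite expr1n.
apply: (rat_cvg_near _ H); exists 1%N => n n0; rewrite mulrDl divff //.
by rewrite pnatr_eq0 -lt0n.
Qed.

Lemma ffact_bounds q x : (x ^ q <= (q + x) ^_ q <= (q + x) ^ q)%N.
Proof.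
rewrite ffact_prod -[X in (_ <= _ <= (q + x) ^ X)%N](card_ord q).
rewrite -[X in (x ^ X <= _ <= _)%N](card_ord q) -!prod_nat_const.
apply/andP; split; apply: leq_prod => i _; last exact: leq_subr.
by rewrite leq_subRL ?leq_add2r ?(ltnW (ltn_ord _)) // (leq_trans (ltnW (ltn_ord i))) // leq_addr.
Qed.

(** The Hilbert function of a polynomial ring in [q + 1] variables, shifted by
    a constant, has leading term [n ^ q / q!]. *)
Lemma rat_cvg_bin q c :
  rat_cvg (fun n => q`!%:R * ('C(q + (n - c), q)%:R / n%:R ^+ q)) 1.
Proof.
apply: rat_squeeze (rat_cvg_shift_ratio (- c%:R) q) (rat_cvg_shift_ratio q%:R q).
exists c.+1 => n cn; have n0 : 0 < n%:R :> rat by rewrite ltr0n (leq_trans _ cn).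
have nq0 : 0 < n%:R ^+ q :> rat by rewrite exprn_gt0.
rewrite mulrA -natrM mulnC bin_ffact !expr_div_n !ler_pM2r ?invr_gt0 //.
have /andP[H1 H2] := ffact_bounds q (n - c).
rewrite -natrB ?(ltnW cn) // -natrD -!natrX !ler_nat H1 (leq_trans H2) //.
by case: (q) => // q'; rewrite leq_exp2r // addnC leq_add2r leq_subr.
Qed.

End RationalLimits.

(** * The Koszul complex of the variables *)

Section Koszul.
Variables (K : fieldType) (s : nat).
Local Notation S := {mpoly K[s]}.
(** The order in which exterior products are written is left free. *)
Variable rk : 'I_s -> nat.
Hypothesis rk_inj : injective rk.
Implicit Types (T : {set 'I_s}) (u v : 'I_s) (m : 'X_{1..s}).

(** The number of transpositions that move [v] to its place in [T]. *)
Definition ninv v T := #|[set u in T | (rk u < rk v)%N]|.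

Definition ksign v T : S := (-1) ^+ ninv v T.

Lemma ninvU u v T : v \notin T -> ninv u (v |: T) = ((rk v < rk u)%N + ninv u T)%N.
Proof.
move=> vT; rewrite /ninv; have [vu|uv] := boolP (rk v < rk u)%N.
  have -> : [set w in v |: T | (rk w < rk u)%N] = v |: [set w in T | (rk w < rk u)%N].
    by apply/setP => w; rewrite !inE; case: eqVneq => [->|].
  by rewrite cardsU1 inE (negbTE vT).
rewrite add0n; apply: eq_card => w; rewrite !inE.
by case: (eqVneq w v) => [->|_] //=; rewrite (negbTE uv) andbF.
Qed.

Lemma ninv_min v T : {in T, forall u, (rk v <= rk u)%N} -> ninv v T = 0%N.
Proof.
move=> H; rewrite /ninv (eq_card (B := set0)) ?cards0 // => u; rewrite !inE.
by apply/negP => /andP[/H]; rewrite leqNgt => /negbTE ->.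
Qed.

Section Boundary.
Variable V : lmodType S.

(** The Koszul differential on the variables, with coefficients in [V]; the
    value of a chain at [T] is its coefficient on the exterior product of [T]. *)
Definition kbd (z : {set 'I_s} -> V) T : V :=
  \sum_(v | v \notin T) (ksign v T * 'X_v) *: z (v |: T).

Lemma eq_kbd z z' : z =1 z' -> kbd z =1 kbd z'.
Proof. by move=> E T; apply: eq_bigr => v _; rewrite E. Qed.

Lemma kbdB z z' T : kbd (fun T => z T - z' T) T = kbd z T - kbd z' T.
Proof. by rewrite -sumrB; apply: eq_bigr => v _; rewrite scalerBr. Qed.

(** The terms for the ordered pairs (v, u) and (u, v) cancel. *)
Lemma kbd_kbd z T : kbd (kbd z) T = 0.
Proof.
pose F v u := if [&& v \notin T, u \notin T & u != v] then
   (ksign v T * 'X_v * (ksign u (v |: T) * 'X_u)) *: z (u |: (v |: T)) else 0.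
have FN v u : u != v -> F v u = - F u v.
  move=> uv; rewrite /F uv (eq_sym v) uv !andbT.
  have [vT|] := boolP (v \in T); first by rewrite andbF oppr0.
  have [uT|uT vT] := boolP (u \in T); first by rewrite oppr0.
  rewrite setUCA -scaleNr; congr (_ *: _); rewrite /ksign !ninvU // !exprD.
  have : rk u != rk v by rewrite (inj_eq rk_inj).
  by case: ltngtP => // _ _; rewrite ?expr0 ?expr1; ring.
have -> : kbd (kbd z) T = \sum_v \sum_u F v u.
  rewrite /kbd big_mkcond; apply: eq_bigr => v _.
  case: ifP => vT; last by rewrite big1 // => u _; rewrite /F vT.
  rewrite scaler_sumr big_mkcond; apply: eq_bigr => u _.
  by rewrite /F vT /= in_setU1 negb_or andbC; case: ifP; rewrite ?scalerA.
pose L v u := (rk v < rk u)%N.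
have -> : \sum_v \sum_u F v u =
    \sum_v \sum_(u | L v u) F v u + \sum_v \sum_(u | L u v) F v u.
  rewrite -big_split; apply: eq_bigr => v _; rewrite (bigID (L v)) /=; congr (_ + _).
  rewrite [LHS]big_mkcond [RHS]big_mkcond; apply: eq_bigr => u _; rewrite /L.
  case: ltngtP => //= /rk_inj ->; by rewrite /F eqxx !andbF.
rewrite [X in _ + X](exchange_big_dep predT) //= -big_split big1 // => v _.
rewrite -big_split big1 // => u; rewrite /L /= => vu; rewrite (FN v u) ?subrr //.
  by rewrite addrC subrr.
by apply: contraTneq vu => ->; rewrite ltnn.
Qed.

End Boundary.

Definition below v m := [forall u, (rk u < rk v)%N ==> (m u == 0%N)].

(** The part of the contracting homotopy that belongs to the variable [v]: it
    strips [v] from the monomials in which no smaller variable occurs. *)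
Definition kdiv v (p : S) : S :=
  \sum_(m <- msupp p | (m v != 0%N) && below v m) p@_m *: 'X_[m - U_(v)].

Lemma mcoeff_kdiv v p m : (kdiv v p)@_m = (below v m)%:R * p@_(m + U_(v)).
Proof.
rewrite /kdiv (raddf_sum (mcoeff m)) /=.
have E m' : m' v != 0%N -> ((m' - U_(v))%MM == m) = (m' == (m + U_(v))%MM).
  move=> m'v; have le : (U_(v) <= m')%MM by rewrite lep1mP.
  by rewrite -(eqm_add2r U_(v)) submK.
have Eb : below v (m + U_(v)) = below v m.
  apply: eq_forallb => u; case: (ltnP (rk u) (rk v)) => //= uv.
  rewrite mnmDE mnm1E; case: (eqVneq v u) uv => [->|_ _]; first by rewrite ltnn.
  by rewrite addn0.
have mv : (m + U_(v))%MM v != 0%N by rewrite mnmDE mnm1E eqxx addn1.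
rewrite (eq_bigr (fun m' => p@_m' * (m' == (m + U_(v))%MM)%:R)); last first.
  by move=> m' /andP[/E H _]; rewrite mcoeffZ mcoeffX H.
have [b|/negbTE b] := boolP (below v m); last first.
  rewrite mul0r big1 // => m' /andP[_ bm'].
  case: (eqVneq m' (m + U_(v))%MM) => [E'|]; last by rewrite mulr0.
  by move: bm'; rewrite E' Eb b.
rewrite mul1r; have [ms|/memN_msupp_eq0 p0] := boolP ((m + U_(v))%MM \in msupp p).
  rewrite big_mkcond (bigD1_seq (m + U_(v))%MM) ?msupp_uniq //= mv Eb b eqxx mulr1.
  by rewrite big1 ?addr0 // => m' /negbTE ->; rewrite mulr0; case: ifP.
rewrite p0 big1 // => m' _.
case: (eqVneq m' (m + U_(v))%MM) => [->|]; last by rewrite mulr0.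
by rewrite p0 mul0r.
Qed.

Lemma mcoeff_mulX v (p : S) m :
  ('X_v * p)@_m = (m v != 0%N)%:R * p@_(m - U_(v)).
Proof.
have [mv|mv] := boolP (m v != 0%N).
  have le : (U_(v) <= m)%MM by rewrite lep1mP.
  by rewrite mul1r mulrC -{1}(submK le) addmC mcoeffMX.
rewrite mul0r; apply/eqP; apply: contraNT mv => /mcoeffM_neq0[m1 [m2 [h _ ->]]].
move: h; rewrite mcoeffX; case: (eqVneq U_(v)%MM m1) => [<- _|]; last by rewrite eqxx.
by rewrite mnmDE mnm1E eqxx.
Qed.

Lemma mcoeff_sign n (p : S) m : ((-1) ^+ n * p)@_m = (-1) ^+ n * p@_m.
Proof.
rewrite -signr_odd -[in RHS]signr_odd; case: odd; rewrite ?expr0 ?mul1r //.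
by rewrite !expr1 !mulN1r mcoeffN.
Qed.

Lemma mcoeff_kbd (z : {set 'I_s} -> S^o) T m : (kbd z T : S)@_m =
  \sum_(v | (v \notin T) && (m v != 0%N))
     (-1) ^+ ninv v T * (z (v |: T) : S)@_(m - U_(v)).
Proof.
rewrite (raddf_sum (mcoeff m)) big_mkcondr; apply: eq_bigr => v vT.
rewrite /GRing.scale /= /ksign -mulrA mcoeff_sign mcoeff_mulX.
by case: (m v != 0%N); rewrite ?mul1r // mul0r mulr0.
Qed.

(** Being the least variable of a term is preserved by the differential and by
    the homotopy. *)
Definition lowest v T m :=
  [forall u, ((m u != 0%N) || (u \in T)) ==> (rk v <= rk u)%N].

Lemma lowestP v T m :
  reflect (forall u, (m u != 0%N) || (u \in T) -> (rk v <= rk u)%N) (lowest v T m).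
Proof. by apply: (iffP forallP) => H u; apply/implyP; apply: H. Qed.

Lemma lowest_exists T m :
  [exists u, (m u != 0%N) || (u \in T)] ->
  exists2 v, (m v != 0%N) || (v \in T) & lowest v T m.
Proof.
case/existsP => u0 Hu0.
case: (arg_minnP (P := fun u => (m u != 0%N) || (u \in T)) rk Hu0) => v Hv min.
by exists v => //; apply/lowestP.
Qed.

(** The variables form a regular sequence, so their Koszul complex is exact
    outside its constant term.  The homotopy exchanges the least variable of a
    basis element between its monomial and its exterior factor. *)
Lemma kbd_exact (z : {set 'I_s} -> S^o) : (forall T, kbd z T = 0) ->
  (z set0 : S)@_0%MM = 0 -> exists w : {set 'I_s} -> S^o, forall T, z T = kbd w T.
Proof.
move=> z0 zc; pose w T : S^o :=
  \sum_(t in T | [forall u in T, (rk t <= rk u)%N]) kdiv t (z (T :\ t)).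
have wE T m t : lowest t T m -> (m t != 0%N) || (t \in T) ->
    (w T : S)@_m = (t \in T)%:R * (z (T :\ t) : S)@_(m + U_(t)).
  move=> /lowestP tmin tmT; rewrite (raddf_sum (mcoeff m)) /=.
  have [tT|tT] := boolP (t \in T).
    rewrite (bigD1 t) ?tT /=; last first.
      by apply/forall_inP => u uT; apply: tmin; rewrite uT orbT.
    rewrite big1 ?addr0 => [|u /andP[/andP[uT /forall_inP umin] ut]]; last first.
      case/eqP: ut; apply: rk_inj; apply/eqP; rewrite eqn_leq umin //.
      by rewrite tmin // uT orbT.
    rewrite mcoeff_kdiv; have -> // : below t m.
    apply/forallP => u; apply/implyP => ut; apply: contraTT ut => mu.
    by rewrite -leqNgt; apply: tmin; rewrite mu.
  rewrite mul0r big1 // => u /andP[uT /forall_inP umin].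
  rewrite mcoeff_kdiv; move: tmT; rewrite (negbTE tT) orbF => mt.
  have -> : below u m = false.
    apply/negP => /forallP/(_ t); rewrite (negbTE mt) implybF -leqNgt => ut.
    have tu : (rk t <= rk u)%N by apply: tmin; rewrite uT orbT.
    have E : u = t by apply: rk_inj; apply/eqP; rewrite eqn_leq ut.
    by rewrite E (negbTE tT) in uT.
  by rewrite mul0r.
exists w => T; apply/mpolyP => m; rewrite mcoeff_kbd.
have [/lowest_exists[t tmT tlow]|empty] := boolP [exists u, (m u != 0%N) || (u \in T)];
    last first.
  have nu u : (m u = 0%N) /\ (u \notin T).
    move: empty; rewrite negb_exists => /forallP/(_ u).
    by rewrite negb_or negbK => /andP[/eqP].
  have -> : T = set0 by apply/setP => u; rewrite inE; apply/negbTE; case: (nu u).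
  have -> : m = 0%MM by apply/mnmP => u; rewrite mnm0E; case: (nu u).
  by rewrite zc big1 // => v /andP[_]; rewrite mnm0E.
have tmin := lowestP _ _ _ tlow.
have low_step v : v \notin T -> m v != 0%N -> (w (v |: T) : S)@_(m - U_(v)) =
    (t \in v |: T)%:R * (z ((v |: T) :\ t) : S)@_(m - U_(v) + U_(t)).
  move=> vT mv; apply: wE.
    apply/lowestP => u; rewrite mnmBE mnm1E in_setU1 => H; apply: tmin; move: H.
    case: (eqVneq v u) => [<-|uv] /=; first by rewrite mv.
    by rewrite subn0.
  rewrite mnmBE mnm1E in_setU1; case: (eqVneq v t) => [|vt] /=; first by rewrite orbT.
  by rewrite subn0.
(* If t is not in T, the only term of the boundary of w is the one that adds t
   to T and gives back z T. Otherwise the terms are compared with those of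
   the vanishing boundary of z at T without t. *)
have [tT|tT] := boolP (t \in T); last first.
  move: (tmT); rewrite (negbTE tT) orbF => mt.
  rewrite (bigD1 t) ?tT ?mt //= low_step // in_setU1 eqxx mul1r.
  rewrite setU1K // submK ?lep1mP // big1 ?addr0 => [|v /andP[/andP[vT mv] vt]].
    by rewrite ninv_min ?mul1r // => u uT; rewrite tmin // uT orbT.
  by rewrite low_step // in_setU1 eq_sym (negbTE vt) (negbTE tT) mul0r mulr0.
have := congr1 (mcoeff (m + U_(t))) (z0 (T :\ t)).
rewrite mcoeff0 mcoeff_kbd (bigD1 t) /=; last first.
  by rewrite setD11 mnmDE mnm1E eqxx addn1.
rewrite setD1K // addmK ninv_min ?mul1r; last first.
  by move=> u; rewrite in_setD1 => /andP[_ uT]; rewrite tmin // uT orbT.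
move/eqP; rewrite addr_eq0 => /eqP ->; rewrite -sumrN.
apply: eq_big => [v|v /andP[/andP[vT mv] vt]].
  rewrite in_setD1 mnmDE mnm1E negb_and negbK; case: (eqVneq v t) => [->|vt].
    by rewrite tT andbF.
  by rewrite /= addn0 ?andbT.
move: vT mv; rewrite in_setD1 vt /= mnmDE mnm1E [t == v]eq_sym (negbTE vt) addn0 => vT mv.
rewrite low_step // in_setU1 tT orbT mul1r -mulNr; congr (_ * (z _)@_ _).
- have tv : (rk t < rk v)%N.
    by rewrite ltn_neqAle (inj_eq rk_inj) eq_sym vt tmin // mv.
  by rewrite -[in RHS](setD1K tT) ninvU ?setD11 // tv add1n exprS mulN1r.
- apply/mnmP => u; rewrite mnmDE !mnmBE mnmDE !mnm1E.
  case: (eqVneq v u) => [<-|_]; last by rewrite !subn0.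
  by rewrite addnBAC // lt0n.
- apply/setP => u; rewrite !inE; case: (eqVneq u v) => [->|] //=.
  by rewrite vt.
Qed.

End Koszul.

(** * Lifting Koszul cycles along a graded resolution *)

Section HomogeneousComponents.
Variables (K : fieldType) (s : nat).
Local Notation S := {mpoly K[s]}.
Implicit Types (p q : S) (m : 'X_{1..s}).

(** The part of degree [D] of an element of S(-c). *)
Definition shifted_part (c D : nat) p : S :=
  if (c <= D)%N then pihomog mdeg (D - c) p else 0.

Lemma mcoeff_shifted_part c D p m :
  (shifted_part c D p)@_m = ((mdeg m + c)%N == D)%:R * p@_m.
Proof.
rewrite /shifted_part; case: leqP => cD; last first.
  by rewrite mcoeff0 gtn_eqF ?mul0r // (leq_trans cD) // leq_addl.
have -> : ((mdeg m + c)%N == D) = (mdeg m == (D - c)%N) by lia.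
have H := pihomogP mdeg (D - c) p.
have [E|ne] := eqVneq (mdeg m) (D - c)%N; last first.
  by rewrite mul0r (dhomog_nemf_coeff H).
rewrite mul1r pihomogE (raddf_sum (mcoeff m)) /=.
rewrite (eq_bigr (fun m' => p@_m' * (m' == m)%:R)); last first.
  by move=> m' _; rewrite mcoeffZ mcoeffX.
have [ms|/memN_msupp_eq0 p0] := boolP (m \in msupp p).
  rewrite big_mkcond (bigD1_seq m) ?msupp_uniq //= E !eqxx mulr1.
  by rewrite big1 ?addr0 // => m' /negbTE ->; rewrite mulr0; case: ifP.
rewrite p0 big1 // => m' _; case: (eqVneq m' m) => [->|_]; last by rewrite mulr0.
by rewrite p0 mul0r.
Qed.

Lemma shifted_partM c k D p q : q \is k.-homog ->
  shifted_part c D (p * q) = shifted_part (c + k) D p * q.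
Proof.
move=> qk; apply/mpolyP => m; rewrite mcoeff_shifted_part !mcoeffM mulr_sumr.
apply: eq_bigr => -[m1 m2] /= /eqP/(congr1 (@mdeg s)); rewrite mdegD => Em.
rewrite mcoeff_shifted_part mulrA.
have [->|q0] := eqVneq (q@_m2) 0; first by rewrite !mulr0.
have Ek : mdeg m2 = k by move/dhomogP: qk; apply; rewrite mcoeff_msupp.
by congr (_ %:R * _ * _); congr (_ == _); lia.
Qed.

Lemma shifted_part_sum c D (I : Type) (r : seq I) (F : I -> S) :
  shifted_part c D (\sum_(i <- r) F i) = \sum_(i <- r) shifted_part c D (F i).
Proof.
apply/mpolyP => m; rewrite mcoeff_shifted_part !(raddf_sum (mcoeff m)) mulr_sumr.
by apply: eq_bigr => i _; rewrite /= mcoeff_shifted_part.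
Qed.

End HomogeneousComponents.

Section Zigzag.
Variables (K : fieldType) (s : nat).
Local Notation S := {mpoly K[s]}.
Variables (J : {pred S}) (F : min_free_resolution J).
Variable rk : 'I_s -> nat.
Hypothesis rk_inj : injective rk.
Implicit Types (T : {set 'I_s}) (m : 'X_{1..s}).
Local Notation Fr i := 'rV[S]_(size (shifts F i)).
Local Notation chain i := ({set 'I_s} -> Fr i).
Local Notation dF := (diff F).

Definition row_part i c D (w : Fr i) : Fr i :=
  \row_q shifted_part (nth 0%N (shifts F i) q + c) D (w 0 q).

Lemma row_part_diff i c D (w : Fr i.+1) :
  row_part c D (w *m dF i) = row_part c D w *m dF i.
Proof.
apply/rowP => q; rewrite !mxE shifted_part_sum; apply: eq_bigr => p _.
rewrite mxE; have [->|/diff_graded[k E hk]] := eqVneq (dF i p q) 0.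
  rewrite !mulr0; apply/mpolyP => m.
  by rewrite mcoeff_shifted_part mcoeff0 mulr0.
by rewrite (shifted_partM _ _ _ hk) E addnAC.
Qed.

(** A chain with coefficients in the [i]-th module of the resolution,
    concentrated in exterior degree [j] and total degree [D]. *)
Definition bihomog i j D (z : chain i) :=
  forall T, row_part #|T| D (z T) = z T /\ (#|T| != j -> z T = 0).

Lemma kbd_mulmx i (z : chain i.+1) T :
  kbd rk (fun T => z T *m dF i) T = kbd rk z T *m dF i.
Proof.
rewrite /kbd mulmx_suml; apply: eq_bigr => v _; exact: scalemxAl.
Qed.

Lemma kbd_entry i (z : chain i) T q :
  kbd rk z T 0 q = kbd rk (fun T => z T 0 q : S^o) T.
Proof. by rewrite /kbd summxE; apply: eq_bigr => v _; rewrite mxE. Qed.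

Lemma row_partP i c D (w : Fr i) :
  row_part c D w = w <->
  forall q m, (w 0 q)@_m != 0 -> (mdeg m + (nth 0 (shifts F i) q + c))%N = D.
Proof.
split=> [<- q m|H].
  rewrite mxE mcoeff_shifted_part; case: (eqVneq _ D) => // _.
  by rewrite mul0r eqxx.
apply/rowP => q; rewrite mxE; apply/mpolyP => m; rewrite mcoeff_shifted_part.
have [->|/H ->] := eqVneq ((w 0 q)@_m) 0; first by rewrite mulr0.
by rewrite eqxx mul1r.
Qed.

Lemma row_part_kbd i j D (z : chain i) T :
  bihomog j D z -> row_part #|T| D (kbd rk z T) = kbd rk z T.
Proof.
move=> hz; apply/row_partP => q m; rewrite kbd_entry mcoeff_kbd => nz.
have [v /andP[/andP[vT mv] zv]] : exists v, [&& (v \notin T) && (m v != 0%N) &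
    (z (v |: T) 0 q)@_(m - U_(v)) != 0].
  apply: contrapT => H; case/eqP: nz; apply: big1 => v Hv.
  have [->|zv] := eqVneq ((z (v |: T) 0 q)@_(m - U_(v))) 0; first by rewrite mulr0.
  by case: H; exists v; rewrite Hv.
have /row_partP/(_ _ _ zv) := (hz (v |: T)).1.
rewrite cardsU1 vT => <-; have le : (U_(v) <= m)%MM by rewrite lep1mP.
by rewrite -{1}(submK le) mdegD mdeg1; lia.
Qed.

(** A lift exists by assumption; its component of the right bidegree is again a
    lift, because the differential of the resolution is graded. *)
Lemma bihomog_lift i j D (z : chain i) : bihomog j.+1 D z ->
  (forall T, exists v, kbd rk z T = v *m dF i) ->
  exists2 z' : chain i.+1, bihomog j D z' & forall T, z' T *m dF i = kbd rk z T.
Proof.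
move=> hz Hz; pose y T := projT1 (cid (Hz T)).
have yP T : kbd rk z T = y T *m dF i by exact: projT2 (cid (Hz T)).
exists (fun T => if #|T| == j then row_part #|T| D (y T) else 0) => T.
  split=> [|/negbTE -> //]; case: ifP => _; apply/row_partP => q m; last first.
    by rewrite mxE mcoeff0 eqxx.
  rewrite mxE mcoeff_shifted_part; case: (eqVneq _ D) => // _.
  by rewrite mul0r eqxx.
case: ifP => [_|Tj]; first by rewrite -row_part_diff -yP (row_part_kbd _ hz).
rewrite mul0mx /kbd big1 // => v vT; rewrite (hz _).2 ?scaler0 //.
by rewrite cardsU1 vT eqSS Tj.
Qed.

Lemma kbd_exact_row i (z : chain i) : (forall T, kbd rk z T = 0) ->
  (forall q, (z set0 0 q)@_0%MM = 0) -> exists w : chain i, forall T, z T = kbd rk w T.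
Proof.
move=> z0 zc.
have H q : exists w : {set 'I_s} -> S^o, forall T, z T 0 q = kbd rk w T.
  by apply: kbd_exact => // T; rewrite -kbd_entry z0 mxE.
pose w q := projT1 (cid (H q)).
have wP q T : z T 0 q = kbd rk (w q) T by exact: (projT2 (cid (H q))).
exists (fun T => \row_q w q T) => T; apply/rowP => q.
by rewrite kbd_entry wP; apply: eq_bigr => v _; rewrite mxE.
Qed.

(** Balancing of Tor: lift [z] along the resolution until its exterior degree is
    zero.  There it has no constant terms if no generator has degree [D], hence
    bounds, and the bounding chains descend back. *)
Lemma zigzag a D j : D \notin shifts F a ->
  forall i (z : chain i), (i + j)%N = a -> bihomog j D z ->
  (forall T, exists v, kbd rk z T = v *m dF i) ->
  exists (w : chain i) (w' : chain i.+1), forall T, z T = kbd rk w T + w' T *m dF i.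
Proof.
move=> Da; elim: j => [|j IH] i z ija hz Hz.
  rewrite addn0 in ija.
  have [w Hw] : exists w : chain i, forall T, z T = kbd rk w T.
    apply: kbd_exact_row => [T|q].
      rewrite /kbd big1 // => v vT; rewrite (hz _).2 ?scaler0 //.
      by rewrite cardsU1 vT.
    apply/eqP; apply: contraNT Da => nz; have /row_partP/(_ q 0%MM nz) := (hz set0).1.
    by rewrite mdeg0 cards0 addn0 add0n -ija => <-; rewrite mem_nth.
  by exists w, (fun=> 0) => T; rewrite Hw mul0mx addr0.
have [z' hz' Ez'] := bihomog_lift hz Hz.
have Hz' T : exists v, kbd rk z' T = v *m dF i.+1.
  apply/diff_exact; rewrite -kbd_mulmx.
  by rewrite (eq_kbd _ Ez') kbd_kbd.
have [w1 [w1' E]] := IH i.+1 z' (etrans (addSnnS i j) ija) hz' Hz'.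
pose y T := z T - w1 T *m dF i.
have y0 T : kbd rk y T = 0.
  rewrite kbdB kbd_mulmx -Ez' E mulmxDl -mulmxA.
  have -> : dF i.+1 *m dF i = 0.
    apply/row_matrixP => p; rewrite row_mul row0; apply/diff_exact.
    by exists (delta_mx 0 p); rewrite rowE.
  by rewrite mulmx0 addr0 subrr.
have [w Hw] : exists w : chain i, forall T, y T = kbd rk w T.
  apply: kbd_exact_row => // q; rewrite !mxE (hz set0).2 ?cards0 // mxE sub0r.
  rewrite mcoeffN (raddf_sum (mcoeff 0%MM)) big1 ?oppr0 // => p _.
  have /eqP d0 : dF i p q \in @irrelevant K s by apply: diff_minimal.
  by rewrite /= mcoeff0_is_multiplicative d0 mulr0.
by exists w, w1 => T; rewrite -Hw subrK.
Qed.

End Zigzag.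

(** * Induced matchings and Betti numbers *)

Section Matching.
Variables (K : fieldType) (s : nat).
Local Notation S := {mpoly K[s]}.
Variables (Y : {set 'I_s}) (tau : 'I_s -> 'I_s) (rk : 'I_s -> nat).
Implicit Types (T : {set 'I_s}) (u v y : 'I_s) (m : 'X_{1..s}).
Hypothesis rk_inj : injective rk.
Hypothesis tauK : {in Y, forall y, tau (tau y) = y}.
Hypothesis tauY : {in Y, forall y, tau y \notin Y}.
Hypothesis rk_tau : {in Y, forall y u, u != y -> u != tau y ->
  (rk u < rk y)%N = (rk u < rk (tau y))%N}.

Definition matched := Y :|: tau @: Y.

Lemma matchedP v : v \in matched -> v \in Y \/ exists2 y, y \in Y & v = tau y.
Proof. by rewrite in_setU => /orP[|/imsetP]; [left|right]. Qed.

Lemma tau_matched v : v \in matched ->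
  [/\ tau v \in matched, tau (tau v) = v, v != tau v & (tau v \in Y) = (v \notin Y)].
Proof.
have yP y : y \in Y -> y != tau y.
  by move=> yY; apply/eqP => E; move: (tauY yY); rewrite -E yY.
case/matchedP => [vY|[y yY ->]].
  by rewrite tauK // yP // vY (negbTE (tauY vY)) !inE imset_f // orbT.
by rewrite tauK // yY tauY // eq_sym yP // !inE yY.
Qed.

Definition transversal T :=
  (T \subset matched) && [forall v in matched, (v \in T) != (tau v \in T)].

Lemma transversalP T : reflect
  (T \subset matched /\ {in matched, forall v, (v \in T) != (tau v \in T)})
  (transversal T).
Proof.
by apply: (iffP andP) => -[sub /forall_inP H].
Qed.

(** This picks out the multidegree in which every matched variable occurs once.
    For a single edge {x, y} it is the functional on
    Koszul chains that sends both x e_y and y e_x to 1, hence their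
    difference, a boundary, to 0; in general it is a tensor product of these. *)
Definition kfunctional (w : {set 'I_s} -> S^o) : K :=
  \sum_(T | transversal T) (w T : S)@_(mesym1 (matched :\: T)).

Definition swap (p : {set 'I_s} * 'I_s) := (p.2 |: p.1 :\ tau p.2, tau p.2).

Lemma swap_transversal T v : transversal T -> v \in matched :\: T ->
  let T' := v |: T :\ tau v in
  [/\ transversal T', tau v \in matched :\: T', tau v |: T' = v |: T &
      tau v |: T' :\ v = T].
Proof.
move=> /transversalP[TM HT]; rewrite in_setD => /andP[vT vM] T'.
have [tM tK vt tY] := tau_matched vM.
have tT : tau v \in T by have := HT v vM; rewrite (negbTE vT); case: (tau v \in T).
split.
- apply/transversalP; split.
    apply/subsetP => u; rewrite !inE => /predU1P[->|/andP[_ /(subsetP TM)]];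
      by move: vM; rewrite !inE.
  move=> u uM; have [tuM tuK utu _] := tau_matched uM.
  rewrite !in_setU1 !in_setD1; have := HT u uM.
  have [->|uv] := eqVneq u v; first by rewrite !eqxx [tau v == v]eq_sym (negbTE vt).
  have [Et|tuv] := eqVneq (tau u) v.
    have -> : u = tau v by rewrite -Et tuK.
    by rewrite eqxx.
  have -> : u != tau v by apply: contraNneq tuv => ->; rewrite tK eqxx.
  have -> // : tau u != tau v.
  by apply: contraNneq uv => E; rewrite -tuK E tK eqxx.
- by rewrite in_setD tM in_setU1 in_setD1 eqxx /= orbF eq_sym vt.
- by rewrite setUCA setD1K.
- by rewrite setU1K ?setD1K // in_setD1 (negbTE vT) andbF.
Qed.

(** The value of [w] at a set that contains both [v] and [tau v] enters the
    boundary at two transversals, which are exchanged by [swap].  The signs differ because [v] and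
    [tau v] are adjacent in the order. *)
Lemma kfunctional_kbd (w : {set 'I_s} -> S^o) : kfunctional (kbd rk w) = 0.
Proof.
pose Q (p : {set 'I_s} * 'I_s) := transversal p.1 && (p.2 \in matched :\: p.1).
pose f p := (-1) ^+ ninv rk p.2 p.1 *
  (w (p.2 |: p.1) : S)@_(mesym1 (matched :\: (p.2 |: p.1))).
have -> : kfunctional (kbd rk w) = \sum_(p | Q p) f p.
  rewrite /kfunctional /Q -(pair_big_dep _ (fun T v => v \in matched :\: T)
     (fun T v => f (T, v))) /=.
  apply: eq_bigr => T _; rewrite mcoeff_kbd; apply: eq_big => [v|v /andP[vT]].
    by rewrite mnmE in_setD eqb0 negbK andbA andbb.
  rewrite mnmE eqb0 negbK => vM; congr (_ * (w _)@_ _); apply/mnmP => u.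
  rewrite mnmBE mnm1E !mnmE !inE; case: (eqVneq u v) => [->|_] /=; last by rewrite subn0.
  by move: vM; rewrite !inE => ->.
have QP p : Q p -> [/\ Q (swap p), swap (swap p) = p,
    ((swap p).2 \in Y) = (p.2 \notin Y) & f (swap p) = - f p].
  case: p => T v /andP[/= tT vMT].
  have [tT' tM E1 E2] := swap_transversal tT vMT.
  move: (vMT); rewrite in_setD => /andP[vT vM].
  have [_ tK vt tY] := tau_matched vM.
  split=> //; first by rewrite /Q /= tT'.
    by rewrite /swap /= tK E2.
  rewrite /f /= E1 -mulNr; congr (_ * _).
  have tauT : tau v \in T.
    by case/transversalP: tT => _ /(_ v vM); rewrite (negbTE vT); case: (tau v \in T).
  have -> : ninv rk v T = ((rk (tau v) < rk v)%N + ninv rk v (T :\ tau v))%N.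
    by rewrite -[in LHS](setD1K tauT) ninvU // setD11.
  rewrite ninvU; last by rewrite in_setD1 (negbTE vT) andbF.
  have -> : ninv rk v (T :\ tau v) = ninv rk (tau v) (T :\ tau v).
    apply: eq_card => u; rewrite !inE; case: eqVneq => //= ut.
    have [uT|//] := boolP (u \in T).
    have uv : u != v by apply: contraNneq vT => <-.
    have [vY|vY] := boolP (v \in Y); first exact: rk_tau.
    by rewrite -[in LHS]tK; symmetry; apply: rk_tau; rewrite ?tY ?tK.
  have : rk (tau v) != rk v by rewrite (inj_eq rk_inj) eq_sym.
  by case: ltngtP => // _ _; rewrite !exprD expr0 expr1 mulN1r mul1r ?opprK.
rewrite (bigID (fun p => p.2 \in Y)) /= [X in _ + X](reindex_onto swap swap) /=.
  rewrite [X in _ + X](eq_bigl (fun p => Q p && (p.2 \in Y))).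
    rewrite -big_split big1 // => p /andP[/QP[_ _ _ ->] _] /=.
    by rewrite subrr.
  move=> p; apply/andP/andP => [[/andP[Qs sY] /eqP E]|[Qp pY]].
    have [Qss _ sY' _] := QP _ Qs; rewrite E in Qss sY'.
    by rewrite Qss sY'.
  have [-> -> -> _] := QP _ Qp; by rewrite pY.
by move=> p /andP[/QP[_ ->]].
Qed.

Variable G : rel 'I_s.
Hypothesis G_irrefl : irreflexive G.
Hypothesis G_tau : {in Y, forall y, G y (tau y)}.
Hypothesis G_induced : {in matched &, forall u v, G u v -> v = tau u}.

(** The complement of a transversal is a transversal, hence independent. *)
Lemma kfunctional_ideal (w : {set 'I_s} -> S^o) :
  (forall T, (w T : S) \in edge_ideal K G) -> kfunctional w = 0.
Proof.
move=> wI; apply: big1 => T /transversalP[TM HT].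
apply/eqP; apply: contraT => /((edge_idealP G_irrefl _).1 (wI T))/negP[].
rewrite mvars_mesym1; apply/indepP => u v; rewrite !in_setD.
move=> /andP[uT uM] /andP[vT vM]; apply/negP => /(G_induced uM vM) E.
by have := HT u uM; rewrite (negbTE uT) -E (negbTE vT).
Qed.

(** The product of the variables in [tau @: Y], placed on the exterior product of
    [Y], is a Koszul cycle modulo the edge ideal.  Without a generator of degree
    [#|Y| + #|Y|] in step [#|Y|] of the resolution, [zigzag] would make it a
    boundary modulo the edge ideal, on which [kfunctional] vanishes. *)
Lemma induced_matching_shift (F : min_free_resolution (edge_ideal K G)) :
  (#|Y| + #|Y|)%N \in shifts F #|Y|.
Proof.
apply: contraT => Da; pose X := tau @: Y.
have cX : #|X| = #|Y|.
  by apply: card_in_imset => y y' yY y'Y /(congr1 tau); rewrite !tauK.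
have XY : matched :\: Y = X.
  apply/setP => v; rewrite !inE; case: (boolP (v \in Y)) => //= vY.
  by apply/esym/negP => /imsetP[y yY E]; rewrite E (negbTE (tauY yY)) in vY.
pose z T : 'rV[S]_(size (shifts F 0)) := if T == Y then const_mx 'X_[mesym1 X] else 0.
have s0 q : nth 0%N (shifts F 0) q = 0%N.
  by rewrite (shifts0 F); case: q => [|[|q]].
have hz : bihomog #|Y| (#|Y| + #|Y|) z.
  move=> T; split=> [|TY]; last by rewrite /z; case: (eqVneq T Y) TY => [->|//]; rewrite eqxx.
  apply/row_partP => q m; rewrite /z; case: (eqVneq T Y) => [->|_]; rewrite mxE.
    rewrite mcoeffX s0 add0n; case: (eqVneq (mesym1 X) m) => [<- _|_]; last by rewrite eqxx.
    by rewrite mdeg_mesym1 cX.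
  by rewrite mcoeff0 eqxx.
have Hz T : exists x, kbd rk z T = x *m diff F 0.
  apply/diff_exact0 => q; rewrite kbd_entry /kbd; apply: ideal_gen_sum => v vT.
  rewrite /GRing.scale /= /ksign /z.
  case: (eqVneq (v |: T) Y) => [E|_]; last by rewrite mxE mulr0 ideal_gen0.
  rewrite mxE -mulrA; apply: ideal_genM; apply/(edge_idealP G_irrefl) => m.
  have vY : v \in Y by rewrite -E setU11.
  rewrite -mpolyXD mcoeffX; case: (eqVneq _ m) => [<- _|_]; last by rewrite eqxx.
  apply/negP => /indepP/(_ v (tau v)); rewrite mvarsD mvars_mesym1 !inE mnm1E eqxx.
  by rewrite imset_f // orbT G_tau // => /(_ isT isT).
have [w [w' E]] := zigzag rk_inj Da (add0n _) hz Hz.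
have q0 : 'I_(size (shifts F 0)) by rewrite (shifts0 F); exact: ord0.
have kz : kfunctional (fun T => z T 0 q0 : S^o) = 1.
  rewrite /kfunctional (bigD1 Y) /=; last first.
    apply/transversalP; split=> [|v vM]; first exact: subsetUl.
    by have [_ _ _ ->] := tau_matched vM; case: (v \in Y).
  rewrite /z eqxx mxE mcoeffX XY eqxx big1 ?addr0 // => T /andP[_ /negbTE ->].
  by rewrite mxE mcoeff0.
have : kfunctional (fun T => z T 0 q0 : S^o) =
    kfunctional (kbd rk (fun T => w T 0 q0 : S^o)) +
    kfunctional (fun T => (w' T *m diff F 0) 0 q0 : S^o).
  rewrite /kfunctional -big_split; apply: eq_bigr => T _.
  by rewrite E mxE kbd_entry mcoeffD.
rewrite kz kfunctional_kbd kfunctional_ideal ?addr0 => [/eqP|T].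
  by rewrite oner_eq0.
exact: ((diff_exact0 (w' T *m diff F 0)).2 (ex_intro _ (w' T) erefl) q0).
Qed.

End Matching.

(** * Dominating sets with private neighbours *)

Section InducedMatching.
Variables (s : nat) (G : rel 'I_s) (B : {set 'I_s}).
Hypothesis G_sym : ssrbool.symmetric G.
Hypothesis G_bip : forall i j, G i j -> (i \in B) != (j \in B).
Hypothesis G_noisol : forall i, exists j, G i j.
Implicit Types (A : {set 'I_s}) (i j x y v : 'I_s).

Lemma G_cross x y : G x y -> (y \in B) = (x \notin B).
Proof. by move/G_bip; case: (x \in B); case: (y \in B). Qed.

Definition dominates A :=
  (A \subset ~: B) && [forall x in B, exists y in A, G x y].

Lemma dominatesP A : reflect
  ({in A, forall y, y \notin B} /\ forall x, x \in B -> exists2 y, y \in A & G x y)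
  (dominates A).
Proof.
apply: (iffP andP) => [[/subsetP sub /forall_inP H]|[sub H]].
  split=> [y /sub|x /H /exists_inP //]; by rewrite inE.
split; first by apply/subsetP => y /sub; rewrite inE.
by apply/forall_inP => x /H ?; apply/exists_inP.
Qed.

(** Removing a vertex from a minimal dominating set leaves some vertex of [B]
    without a neighbour in the set: a private neighbour of the removed one.
    Private neighbours have no other edges to the set, so the matching with
    them is induced. *)
Lemma minimal_dominating_matching : exists A (tau : 'I_s -> 'I_s),
  [/\ dominates A, {in A, forall y, tau y \in B /\ tau (tau y) = y},
      {in A, forall y, G y (tau y)} &
      {in A &, forall y z, G (tau y) z -> z = y}].
Proof.
have dB : dominates (~: B).
  apply/dominatesP; split=> [y|x xB]; first by rewrite inE.
  by have [y xy] := G_noisol x; exists y => //; rewrite inE (G_cross xy) xB.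
have [A minA _] := minset_exists dB; exists A.
have [dA min] := minsetP minA; have [AB domA] := dominatesP _ dA.
pose private y x := [&& x \in B, G x y & [forall z in A, G x z ==> (z == y)]].
have privP y : y \in A -> exists x, private y x.
  move=> yA; have : ~~ dominates (A :\ y).
    apply/negP => /min/(_ (subD1set _ _)) E.
    by have := setD11 y A; rewrite E yA.
  move=> nd; apply: contrapT => H; case/negP: nd; apply/dominatesP; split.
    by move=> z; rewrite in_setD1 => /andP[_]; apply: AB.
  move=> x xB; apply: contrapT => H'; apply: H; exists x.
  have uniq z : z \in A -> G x z -> z = y.
    move=> zA xz; apply/eqP/negPn/negP => zy; apply: H'.
    by exists z; rewrite // in_setD1 zy.
  have [z zA xz] := domA x xB; rewrite /private xB -(uniq z zA xz) xz /=.
  apply/forall_inP => z' z'A; apply/implyP => xz'.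
  by rewrite (uniq z' z'A xz') (uniq z zA xz).
pose pn y := odflt y [pick x | private y x].
have pnP y : y \in A -> private y (pn y).
  by move=> /privP[x Hx]; rewrite /pn; case: pickP => //= /(_ x); rewrite Hx.
have pn_priv : {in A &, forall y z, G (pn y) z -> z = y}.
  move=> y z yA zA yz; have /and3P[_ _ /forall_inP/(_ z zA)] := pnP y yA.
  by rewrite yz => /eqP.
pose tau v := if v \in A then pn v else odflt v [pick y in A | pn y == v].
have tauA y : y \in A -> tau y = pn y by rewrite /tau => ->.
exists tau; split=> //.
- move=> y yA; have /and3P[yB yy _] := pnP y yA; rewrite tauA //; split=> //.
  rewrite /tau; case: ifP => [/AB|_]; first by rewrite yB.
  case: pickP => [z /= /andP[zA /eqP E]|/(_ y)]; last by rewrite /= yA eqxx.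
  have /and3P[_ zz _] := pnP z zA.
  by apply: pn_priv => //; rewrite -E.
- by move=> y yA; rewrite tauA // G_sym; have /and3P[] := pnP y yA.
- by move=> y z yA zA; rewrite tauA //; exact: pn_priv.
Qed.

(** Adjacency of matched vertices in the order is what makes the signs in
    [kfunctional_kbd] opposite. *)
Lemma matching_order A (tau : 'I_s -> 'I_s) :
  {in A, forall y, tau y \notin A /\ tau (tau y) = y} ->
  exists2 rk : 'I_s -> nat, injective rk &
    {in A, forall y u, u != y -> u != tau y -> (rk u < rk y)%N = (rk u < rk (tau y))%N}.
Proof.
move=> Htau; pose X := tau @: A.
pose rk v := if v \in A then (v : nat).*2
  else if v \in X then (tau v : nat).*2.+1 else (s.*2 + v)%N.
have XP v : v \in X -> exists2 y, y \in A & v = tau y by move/imsetP.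
have rkA y : y \in A -> rk y = (y : nat).*2 by rewrite /rk => ->.
have rkX y : y \in A -> rk (tau y) = (y : nat).*2.+1.
  move=> yA; have [tA tK] := Htau y yA.
  by rewrite /rk (negbTE tA) /X imset_f // tK.
have cases v : [\/ v \in A, exists2 y, y \in A & v = tau y | rk v = (s.*2 + v)%N].
  have [vA|vA] := boolP (v \in A); first by constructor 1.
  have [/XP|vX] := boolP (v \in X); first by constructor 2.
  by constructor 3; rewrite /rk (negbTE vA) (negbTE vX).
exists rk.
- move=> u v; have := ltn_ord u; have := ltn_ord v.
  case: (cases u) => [uA|[y yA ->]|->]; case: (cases v) => [vA|[z zA ->]|->];
    rewrite ?rkX ?rkA // => ? ? E; try (apply: val_inj => /=; lia); try lia.
  + by have -> : y = z by apply: val_inj => /=; lia.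
  + by have := ltn_ord y; lia.
  + by have := ltn_ord z; lia.
- move=> y yA u uy uty; rewrite (rkX y yA) (rkA y yA).
  have := ltn_ord y; case: (cases u) => [uA|[z zA E]|->]; last by lia.
    rewrite rkA //; have : (u : nat) <> y by move/val_inj/eqP; rewrite (negbTE uy).
    by lia.
  rewrite E rkX //; have : (z : nat) <> y.
    by move/val_inj => zy; rewrite E zy eqxx in uty.
  by lia.
Qed.

(** The induced matching on a minimal dominating set [A] forces a generator of
    degree [2 * #|A|] in step [#|A|]. *)
Lemma dominating_le_regularity (K : fieldType) (r : int) :
  irreflexive G -> has_regularity (edge_ideal K G) r ->
  exists2 A, dominates A & (#|A|%:Z <= r).
Proof.
move=> G_irrefl [F [_ Fr]].
have [A [tau [dA Htau Gtau priv]]] := minimal_dominating_matching.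
have [AB _] := dominatesP _ dA.
have tauK : {in A, forall y, tau (tau y) = y} by move=> y /Htau[].
have tauA : {in A, forall y, tau y \notin A}.
  by move=> y /Htau[tB _]; apply/negP => /AB; rewrite tB.
have [rk rk_inj rk_tau] : exists2 rk : 'I_s -> nat, injective rk & {in A, forall y u,
    u != y -> u != tau y -> (rk u < rk y)%N = (rk u < rk (tau y))%N}.
  by apply: matching_order => y yA; rewrite tauA // tauK.
have induced : {in matched A tau &, forall u v, G u v -> v = tau u}.
  move=> u v uM vM uv; have := G_cross uv.
  case/matchedP: uM uv => [uA|[y yA ->]]; case/matchedP: vM => [vA|[z zA ->]] uv.
  - by rewrite (negbTE (AB _ uA)) (negbTE (AB _ vA)).
  - by move=> _; congr tau; apply/esym/priv => //; rewrite G_sym.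
  - by move=> _; rewrite tauK //; apply: priv uv.
  - by have [-> _] := Htau y yA; have [-> _] := Htau z zA.
have := induced_matching_shift rk_inj tauK tauA rk_tau G_irrefl Gtau induced F.
rewrite -has_pred1 has_count lt0n => nz; exists A => //.
by have := Fr #|A| (#|A| + #|A|)%N nz; lia.
Qed.

Lemma side_maxindep : maxindep G (~: B).
Proof.
apply/maxsetP; split.
  apply/indepP => i j; rewrite !inE => iB jB; apply/negP => /G_cross.
  by rewrite (negbTE iB) (negbTE jB).
move=> A iA BA; apply/eqP; rewrite eqEsubset BA andbT; apply/subsetP => x xA.
rewrite inE; apply/negP => xB; have [y xy] := G_noisol x.
have yA : y \in A by apply: (subsetP BA); rewrite inE (G_cross xy) xB.
by have /indepP/(_ x y xA yA) := iA; rewrite xy.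
Qed.

(** This identifies the colon ideal of the edge ideal by a monomial with support
    [A] as the linear prime on [B]. *)
Lemma indep_dominating A m : dominates A ->
  indep G (A :|: mvars m) = (mvars m \subset ~: B).
Proof.
move=> dA; have [AB domA] := dominatesP _ dA; apply/idP/idP => [/indepP H|mB].
  apply/subsetP => x xm; rewrite inE; apply/negP => /domA[y yA xy].
  by have := H x y; rewrite !in_setU xm yA orbT xy => /(_ isT isT).
have [iB _] := maxsetP side_maxindep; apply: indepS iB.
by rewrite subUset mB andbT; case/andP: dA.
Qed.

End InducedMatching.

(** * Degrees and the minimum distance *)

Section Degrees.
Variables (K : fieldType) (s : nat).
Local Notation S := {mpoly K[s]}.
Variable G : rel 'I_s.
Hypothesis G_irrefl : irreflexive G.
Variable q : nat.
Local Notation I := (edge_ideal K G).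
Hypothesis dimI : has_krull_dim I q.+1.
Hypothesis depthI : has_depth I q.+1.
Implicit Types (A : {set 'I_s}) (f h : S) (m : 'X_{1..s}).

Let unmixed A : maxindep G A -> #|A| = q.+1.
Proof. exact: (cohen_macaulay_maxindep G_irrefl dimI depthI). Qed.

Local Notation e := (nfacets G).
Local Notation N := (cntindep G).

Lemma hilbert_edge_ideal : has_hilbert_function I N.
Proof. by apply: hilbert_monomial => f; apply: edge_idealP. Qed.

Lemma cntindep_cvg : rat_cvg (fun n => q`!%:R * ((N n)%:R / n%:R ^+ q)) e%:R.
Proof.
have B c := rat_cvgM (rat_cvg_cst e%:R) (rat_cvg_bin q c).
have B1 := B q.+1; have B0 := B 0%N; rewrite !mulr1 in B1 B0.
apply: rat_squeeze B1 B0; exists q.+1 => n qn.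
have mono a b : (a <= b)%N ->
    q`!%:R * (a%:R / n%:R ^+ q) <= q`!%:R * (b%:R / n%:R ^+ q) :> rat.
  by move=> ab; rewrite ler_wpM2l // ler_wpM2r ?ler_nat ?invr_ge0 ?exprn_ge0.
have E c : e%:R * (q`!%:R * (c%:R / n%:R ^+ q)) =
    q`!%:R * ((e * c)%:R / n%:R ^+ q) :> rat by rewrite natrM; ring.
rewrite !E !mono // ?subn0; first exact: cntindep_le.
by have := cntindep_ge unmixed (n - q.+1); rewrite subnK.
Qed.

Lemma degree_edge_ideal : has_degree I e.
Proof.
by exists q.+1 => //=; exists N; [exact: hilbert_edge_ideal | exact: cntindep_cvg].
Qed.

Lemma nfacets_gt0 A : maxindep G A -> (0 < e)%N.
Proof. by move=> mA; rewrite card_gt0; apply/set0Pn; exists A; rewrite inE. Qed.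

Lemma sub_gen (f : S) : {subset I <= ideal_gen [predU1 f & I]}.
Proof. by move=> g gI; apply: mem_ideal_gen; rewrite !inE gI orbT. Qed.

(** A zero divisor lies in a minimal prime, and all minimal primes have the
    dimension of S/I. *)
Lemma krull_zero_divisor d f : zero_divisor_forms I d f ->
  has_krull_dim (ideal_gen [predU1 f & I]) q.+1.
Proof.
case=> [_ fI nzd].
have [h hfI hI] : exists2 h, h * f \in I & h \notin I.
  apply: contrapT => H; apply: nzd => h; rewrite inE.
  apply/idP/idP => [hf|hI]; last by rewrite mulrC; apply: ideal_genM.
  by apply: contraT => hI; case: H; exists h.
have [A mA hA] := notin_edge_ideal G_irrefl hI.
have [iA _] := maxsetP mA; have IA := edge_ideal_linprime (K := K) G_irrefl iA.
have fA : f \in linprime K (~: A).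
  by have := IA _ hfI; rewrite linprimeM (negbTE hA).
split.
  rewrite -(unmixed mA); apply: linprime_chain; apply: ideal_gen_min.
  - exact: linprime0.
  - by move=> a x y xA yA; rewrite linprimeD ?linprimeM ?xA ?orbT.
  - by move=> x; rewrite !inE => /predU1P[->|/IA].
move=> l [P [HP HP']]; apply: dimI.2; exists P; split=> // i il.
have [? ? sub] := HP i il; split=> // g gI; exact/sub/sub_gen.
Qed.

Lemma krull_dim_uniq (J : {pred S}) k k' :
  has_krull_dim J k -> has_krull_dim J k' -> k = k'.
Proof. by move=> [c m] [c' m']; apply/eqP; rewrite eqn_leq m // m'. Qed.

(** A form outside [I] misses a minimal prime, and multiplication by it embeds
    the coordinate ring of that prime in S/I. *)
Lemma hilbert_zero_divisor d f n H : zero_divisor_forms I d f -> (d <= n)%N ->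
  has_quot_dim (@graded_part K s n)
    [predI @graded_part K s n & ideal_gen [predU1 f & I]] H ->
  (H + 'C(q + (n - d), q) <= N n)%N.
Proof.
case=> [fd fI _] dn HH; have [A mA fA] := notin_edge_ideal G_irrefl fI.
have [iA _] := maxsetP mA; have IA := edge_ideal_linprime (K := K) G_irrefl iA.
have := hilbert_add_form IA fA fd dn (hilbert_edge_ideal n) HH.
by rewrite setCK (cntmons_support _ (unmixed mA)).
Qed.

Lemma cntindep_sub_cvg d : rat_cvg
  (fun n => q`!%:R * (((N n)%:R - ('C(q + (n - d), q))%:R) / n%:R ^+ q)) (e%:R - 1).
Proof.
have := rat_cvgD cntindep_cvg (rat_cvgM (rat_cvg_cst (-1)) (rat_cvg_bin q d)).
rewrite mulr1; apply: rat_cvg_near; exists 0%N => n _; ring.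
Qed.

(** Compare leading coefficients: at least one of the minimal primes, each
    contributing 1 to the degree, is lost. *)
Lemma degree_zero_divisor_le d f (m' : nat) : zero_divisor_forms I d f ->
  has_degree (ideal_gen [predU1 f & I]) m' -> (m'.+1 <= e)%N.
Proof.
move=> zf [k /(krull_dim_uniq (krull_zero_divisor zf)) <-] /= [H hH cH].
suff : (m'%:R <= e%:R - 1 :> rat) by rewrite lerBrDr natr1 ler_nat.
apply: rat_cvg_le cH (cntindep_sub_cvg d); exists d => n dn.
rewrite ler_pM2l ?ltr0n ?fact_gt0 // ler_wpM2r ?invr_ge0 ?exprn_ge0 //.
by rewrite lerBrDr -natrD ler_nat; apply: hilbert_zero_divisor zf dn (hH n).
Qed.

Variables (B : {set 'I_s}) (A : {set 'I_s}).
Hypothesis G_bip : forall i j, G i j -> (i \in B) != (j \in B).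
Hypothesis G_noisol : forall i, exists j, G i j.
Hypothesis domA : dominates G B A.

Let sideP := side_maxindep G_bip G_noisol.

Lemma monomial_zero_divisor d m0 x : x \in B -> mvars m0 = A -> mdeg m0 = d ->
  zero_divisor_forms I d 'X_[m0].
Proof.
move=> xB m0A m0d; split.
- by rewrite inE dhomogX; apply/eqP.
- apply/negP => /(edge_idealP G_irrefl)/(_ m0); rewrite mcoeffX eqxx oner_eq0.
  move/(_ isT)/negP; apply; rewrite m0A.
  have := indep_dominating G_bip G_noisol 0%MM domA.
  have -> : mvars (0%MM : 'X_{1..s}) = set0 by apply/setP => i; rewrite !inE mnm0E.
  by rewrite setU0 sub0set.
move/(_ 'X_x); rewrite inE -mpolyXD => H.
have : 'X_[U_(x) + m0] \in I.
  apply/(edge_idealP G_irrefl) => m; rewrite mcoeffX.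
  case: (eqVneq (U_(x) + m0)%MM m) => [<- _|_]; last by rewrite eqxx.
  rewrite mvarsD m0A setUC (indep_dominating G_bip G_noisol) //.
  by apply/subsetPn; exists x; rewrite inE ?mnm1E ?eqxx // xB.
rewrite H => /(edge_idealP G_irrefl)/(_ U_(x)%MM).
rewrite mcoeffX eqxx oner_eq0 => /(_ isT)/negP; apply.
apply/indepP => i j; rewrite !inE !mnm1E !eqb0 !negbK => /eqP <- /eqP <-.
by rewrite G_irrefl.
Qed.

Lemma monomial_adjoinP m0 f : f \in ideal_gen [predU1 'X_[m0] & I] <->
  forall m, f@_m != 0 -> ~~ (indep G (mvars m) && ~~ (m0 <= m)%MM).
Proof.
pose D m := ~~ (indep G (mvars m) && ~~ (m0 <= m)%MM); split.
  have up m m' : D m -> D (m' + m)%MM.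
    rewrite /D !negb_and !negbK => /orP[im|m0m]; apply/orP; [left|right].
      by apply: contra im; apply: indepS; rewrite mvarsD subsetUr.
    exact: lepm_trans m0m (lem_addl _ _).
  move: f; apply: ideal_gen_min.
  - by move=> m; rewrite mcoeff0 eqxx.
  - by move=> a x y Hx Hy m; apply: (upward_closed_ideal up).
  - move=> x; rewrite !inE => /predU1P[-> m|/(edge_idealP G_irrefl) xI m /xI im].
      rewrite mcoeffX; case: (eqVneq m0 m) => [<- _|_]; last by rewrite eqxx.
      by rewrite lepm_refl andbF.
    by rewrite negb_and im.
move=> H; rewrite (mpolyE f) big_seq; apply: ideal_gen_sum => m.
rewrite mcoeff_msupp => /H; rewrite negb_and negbK => /orP[im|m0m]; last first.
  rewrite -(submK m0m) -mul_mpolyC mpolyXD mulrA; apply: ideal_genM.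
  by apply: mem_ideal_gen; rewrite !inE eqxx.
rewrite -mul_mpolyC; apply: ideal_genM; apply: sub_gen.
apply/(edge_idealP G_irrefl) => m'; rewrite mcoeffX.
by case: (eqVneq m m') => [<-|_]; rewrite ?eqxx.
Qed.

(** The colon ideal of [I] by the monomial is the linear prime on [B], so the
    bound of [hilbert_zero_divisor] is attained. *)
Lemma degree_monomial d m0 x : x \in B -> mvars m0 = A -> mdeg m0 = d ->
  has_degree (ideal_gen [predU1 'X_[m0] & I]) e.-1.
Proof.
move=> xB m0A m0d; have zf := monomial_zero_divisor xB m0A m0d.
pose P m := indep G (mvars m) && ~~ (m0 <= m)%MM.
have hP : has_hilbert_function (ideal_gen [predU1 'X_[K, m0] & I]) (cntmons P).
  by apply: hilbert_monomial => f; apply: monomial_adjoinP.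
exists q.+1; first exact: krull_zero_divisor zf.
exists (cntmons P) => //=.
have -> : e.-1%:R = e%:R - 1 :> rat.
  by rewrite -[in RHS](prednK (nfacets_gt0 sideP)) -natr1 addrK.
apply: rat_cvg_near (cntindep_sub_cvg d); exists d => n dn.
congr (_ * (_ / _)); apply/eqP; rewrite subr_eq -natrD eqr_nat eqn_leq.
rewrite (hilbert_zero_divisor zf dn (hP n)) andbT.
rewrite -(cntmons_support _ (unmixed sideP)).
apply: (@leq_trans (cntmons P n +
    cntmons (fun m => indep G (mvars m) && (m0 <= m)%MM) n)).
  rewrite /cntindep !cntmonsE -big_split; apply: leq_sum => m _ /=.
  by rewrite /P; case: indep => //; case: (m0 <= m)%MM.
rewrite leq_add2l; apply: (leq_cntmons (h := fun m => (m - m0)%MM)).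
  move=> m m' /andP[_ le] /andP[_ le'] E.
  by rewrite -(submK le) E submK.
move=> m /andP[im le] dm; rewrite -(submK le) in im dm; split.
  move: im; rewrite mvarsD m0A setUC (indep_dominating G_bip G_noisol) //.
by move: dm; rewrite mdegD m0d => <-; rewrite addnK.
Qed.

End Degrees.

Theorem proposition4p7 (K : fieldType) (s : nat) (G : rel 'I_s)
    (G_sym : ssrbool.symmetric G) (G_irrefl : irreflexive G)
    (G_bip : bipartite G)
    (G_noisol : forall i, exists j, G i j)
    (G_edge : exists i j, G i j)
    (G_CM : cohen_macaulay (edge_ideal K G))
    (r : int) (r_reg : has_regularity (edge_ideal K G) r)
    (d : nat) (d_gt0 : (1 <= d)%N) (r_le_d : r <= d%:Z) :
  has_min_distance (edge_ideal K G) d 1.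
Proof.
have [B bip] := G_bip; have [k [dimI depthI]] := G_CM.
have sideP := side_maxindep bip G_noisol.
have [x xB [y yB]] : exists2 x, x \in B & exists y, y \in ~: B.
  have [i [j ij]] := G_edge; have := G_cross bip ij.
  have [iB jB|iB jB] := boolP (i \in B).
    by exists i => //; exists j; rewrite inE jB.
  by exists j; rewrite ?jB //; exists i; rewrite inE.
have kE := cohen_macaulay_maxindep G_irrefl dimI depthI sideP.
case: k dimI depthI kE => [|q] dimI depthI kE.
  by have := card0_eq kE y; rewrite yB.
have [A domA Ar] := dominating_le_regularity G_sym bip G_noisol G_irrefl r_reg.
have Ad : (#|A| <= d)%N by rewrite -lez_nat (le_trans Ar).
have [a aA] : exists a, a \in A.
  by have [_ /(_ x xB)[a aA _]] := dominatesP _ _ _ domA; exists a.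
(* the product of A, padded to degree d by a vertex of A *)
pose m0 : 'X_{1..s} := (mesym1 A + U_(a) *+ (d - #|A|))%MM.
have m0A : mvars m0 = A.
  rewrite mvarsD mvars_mesym1; apply/setUidPl/subsetP => i.
  by rewrite inE mulmnE mnm1E; case: (eqVneq a i) => [<-|].
have m0d : mdeg m0 = d by rewrite mdegD mdeg_mesym1 mdegMn mdeg1 mul1n subnKC.
have zf := monomial_zero_divisor K G_irrefl bip G_noisol domA xB m0A m0d.
have e0 := nfacets_gt0 sideP.
exists (nfacets G); first exact: degree_edge_ideal dimI depthI.
left; split; first by exists 'X_[m0].
exists (nfacets G).-1; last by lia.
split.
  exists 'X_[m0] => //.
  exact: degree_monomial dimI depthI _ _ bip G_noisol domA _ _ _ xB m0A m0d.
move=> f m' zff hf; have := degree_zero_divisor_le G_irrefl dimI depthI zff hf.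
by lia.
Qed.
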